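(* Let $H$ be a graded Hopf algebra and $(G,\mu,\lambda)$ a graded left $H$-comodule algebra. Let $l\in\mathbb{N}\cup\{\infty\}$, let $(H[t]/(t^{l+1}),m^l,\Delta^l)$ be an $l$-deformation of $H$ and let $(G[t]/(t^{l+1}),\mu^l,\lambda^l)$ be an $l$-deformation of $G$ compatible with the deformation of $H$. Then $$(\mu^l_1,m^l_1)+(\lambda^l_1,\Delta^l_1)\in Z^2_{ca}(G,H),$$ where $(\mu^l_1,m^l_1)\in\mathcal{C}^{2,0}(G,H)$ and $(\lambda^l_1,\Delta^l_1)\in\mathcal{C}^{1,1}(G,H)$; that is, this element of $\operatorname{Tot}^2(\mathcal{C}^{*,*}(G,H))$ is annihilated by the differential of the total complex.
   Context: $\Bbbk$ is an algebraically closed field of characteristic zero. $H=\bigoplus_{i=0}^mH(i)$ is a graded Hopf algebra with product $m$, coproduct $\Delta$; a graded left $H$-comodule algebra is a graded algebra $G=\bigoplus_{i=0}^m G(i)$ (product $\mu$) with a left coaction $\lambda:G\to H\otimes G$ that is an algebra map and satisfies $\lambda(G(n))\subseteq\bigoplus_iH(i)\otimes G(n-i)$. Deformations. For $l\in\mathbb N\cup\{\infty\}$ (with $\Bbbk[t]/(t^{l+1})=\Bbbk[t]$ and $X[t]/(t^{l+1})=X[t]$ if $l=\infty$), grade $H[t]/(t^{l+1})$ and $G[t]/(t^{l+1})$ by $\deg t=1$ and the gradings of $H,G$. An $l$-deformation of $H$ consists of $\Bbbk[t]/(t^{l+1})$-linear maps $m^l:(H\otimes H)[t]/(t^{l+1})\to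 H[t]/(t^{l+1})$, $\Delta^l:H[t]/(t^{l+1})\to(H\otimes H)[t]/(t^{l+1})$, homogeneous of degree $0$, making $H[t]/(t^{l+1})$ a bialgebra over $\Bbbk[t]/(t^{l+1})$; so $m^l(x\otimes y)=\sum_sm^l_s(x\otimes y)t^s$, $\Delta^l(x)=\sum_s\Delta^l_s(x)t^s$ with $m^l_s,\Delta^l_s$ of degree $-s$, and one requires $m^l_0=m$, $\Delta^l_0=\Delta$. An $l$-deformation of $G$ compatible with it consists of $\Bbbk[t]/(t^{l+1})$-linear degree $0$ maps $\mu^l:(G\otimes G)[t]/(t^{l+1})\to G[t]/(t^{l+1})$, $\lambda^l:G[t]/(t^{l+1})\to(H\otimes G)[t]/(t^{l+1})$ making $G[t]/(t^{l+1})$ a left comodule algebra over that bialgebra; $\mu^l=\sum_s\mu^l_st^s$, $\lambda^l=\sum_s\lambda^l_st^s$ with $\mu^l_0=\mu$, $\lambda^l_0=\lambda$. Bialgebra cochains. $C^{p,q}(H)=\operatorname{Hom}_\Bbbk(H^{\otimes p},H^{\otimes q})$ if $p,q\ge1$, and $0$ if $pq=0$. Put (Sweedler notation) $m^s_i(y^1\otimes\dots\otimes y^{s+1})=y^1\otimes\dots\otimes y^iy^{i+1}\otimes\dots\otimes y^{s+1}$; $\Delta^s_i(y^1\otimes\dots\otimes y^s)=y^1\otimes\dots\otimes y^i_{(1)}\otimes y^i_{(2)}\otimes\dots\otimes y^s$; $\lambda^s_l(x\otimes y^1\otimes\dots\otimes y^s)=x_{(1)}y^1\otimes\dots\otimes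 x_{(s)}y^s$; $\lambda^s_r(y^1\otimes\dots\otimes y^s\otimes x)=y^1x_{(1)}\otimes\dots\otimes y^sx_{(s)}$; $\delta^s_l(y^1\otimes\dots\otimes y^s)=y^1_{(1)}\cdots y^s_{(1)}\otimes y^1_{(2)}\otimes\dots\otimes y^s_{(2)}$; $\delta^s_r(y^1\otimes\dots\otimes y^s)=y^1_{(1)}\otimes\dots\otimes y^s_{(1)}\otimes y^1_{(2)}\cdots y^s_{(2)}$. For $f\in C^{p,q}(H)$, $\partial^h_{p,q}f=\lambda^q_l(\operatorname{id}_H\otimes f)+\sum_{i=1}^p(-1)^if\circ m^p_i+(-1)^{p+1}\lambda^q_r(f\otimes\operatorname{id}_H)$, $\partial^v_{p,q}f=(\operatorname{id}_H\otimes f)\delta^p_l+\sum_{i=1}^q(-1)^i\Delta^q_i\circ f+(-1)^{q+1}(f\otimes\operatorname{id}_H)\delta^p_r$. Comodule algebra cochains. For a left $H$-comodule algebra $(A,\mu,\lambda)$: $C^{0,q}(A)=0$, $C^{1,0}(A)=\operatorname{Der}(A)$, and $C^{p,q}(A)=\operatorname{Hom}_\Bbbk(A^{\otimes p},H^{\otimes q}\otimes A)$ otherwise. Put $\lambda^n_1(a^1\otimes\dots\otimes a^n)=a^1_{(-1)}\cdots a^n_{(-1)}\otimes a^1_{(0)}\otimes\dots\otimes a^n_{(0)}$; $\lambda^n_2(a^1\otimes\dots\otimes a^n)=a^1_{(-1)}\otimes\dots\otimes a^n_{(-1)}\otimes a^1_{(0)}\cdots a^n_{(0)}$; $\beta^n_l(a\otimes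 Y\otimes b)=\lambda^n_l(a_{(-1)}\otimes Y)\otimes a_{(0)}b$, $\beta^n_r(Y\otimes a\otimes b)=\lambda^n_r(Y\otimes b_{(-1)})\otimes ab_{(0)}$ for $Y\in H^{\otimes n}$, $a,b\in A$, and $\beta^0_l=\beta^0_r=\mu$; $\mu^n_i(a^1\otimes\dots\otimes a^{n+1})=a^1\otimes\dots\otimes a^ia^{i+1}\otimes\dots\otimes a^{n+1}$. For $f\in C^{p,q}(A)$, $\partial^h_{p,q}f=\beta^q_l(\operatorname{id}_A\otimes f)+\sum_{i=1}^p(-1)^if\circ\mu^p_i+(-1)^{p+1}\beta^q_r(f\otimes\operatorname{id}_A)$, $\partial^v_{p,q}f=(\operatorname{id}_H\otimes f)\lambda^p_1+\sum_{i=1}^q(-1)^i(\Delta^q_i\otimes\operatorname{id}_A)f+(-1)^{q+1}(\operatorname{id}_{H^{\otimes q}}\otimes\lambda)f$. Bicomplex. $\mathcal{C}^{p,q}(A,H)=C^{p,q}(A)\oplus C^{p,q+1}(H)$ with $d^h_{p,q}(\phi,f)=(\partial^h_{p,q}\phi,\ \partial^h_{p,q+1}f)$ and $d^v_{p,q}(\phi,f)=(\partial^v_{p,q}\phi+(-1)^q(f\otimes\operatorname{id}_A)\lambda^p_2,\ \partial^v_{p,q+1}f)$. The total complex is $\operatorname{Tot}^n=\bigoplus_{p+q=n}\mathcal{C}^{p,q}(A,H)$ with differential $d^h_{p,q}+(-1)^pd^v_{p,q}$ on $\mathcal{C}^{p,q}(A,H)$, and $Z^2_{ca}(A,H)$ denotes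 the kernel of this differential on $\operatorname{Tot}^2$. *)

(* Defs.v *)
From HB Require Import structures.
From mathcomp Require Import all_boot all_algebra.
From mathcomp Require Import sesquilinear qpoly.
From mathcomp Require Import boolp functions.

Set Implicit Arguments.
Unset Strict Implicit.
Unset Printing Implicit Defensive.

Import GRing.Theory.
Local Open Scope ring_scope.
Local Open Scope quotient_scope.

(* Tensor product of two modules over a commutative ring: formal sums of
   pairs, two of them being identified when no bilinear map separates them.
   The universal property is given by tliftE and tens_ext. *)

Section TensorProduct.
Variables (R : comNzRingType) (V W : lmodType R).
Implicit Types (s : seq (V * W)) (P : lmodType R).

Definition tens_eval P (B : {bilinear V -> W -> P}) s : P :=
  \sum_(p <- s) B p.1 p.2.

Definition tens_eq s s' : bool :=
  `[< forall P (B : {bilinear V -> W -> P}), tens_eval B s = tens_eval B s' >].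

Fact tens_eq_equiv : equiv_class_of tens_eq.
Proof.
split=> [s|s s'|s2 s1 s3].
- exact/asboolP.
- by apply/asboolP/asboolP => h P B; rewrite h.
- by move=> /asboolP h /asboolP h'; apply/asboolP => P B; rewrite h.
Qed.

Canonical tens_eq_equivRel := EquivRelPack tens_eq_equiv.

Definition tensor := {eq_quot tens_eq}.

HB.instance Definition _ := Choice.on tensor.
HB.instance Definition _ := EqQuotient.on tensor.

Lemma tens_piP s s' :
  (forall P (B : {bilinear V -> W -> P}), tens_eval B s = tens_eval B s') ->
  \pi_tensor s = \pi_tensor s'.
Proof. by move=> h; apply/eqP; rewrite piE; apply/asboolP. Qed.

Lemma tens_eval_pi P (B : {bilinear V -> W -> P}) s :
  tens_eval B (repr (\pi_tensor s)) = tens_eval B s.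
Proof.
have /eqP : \pi_tensor (repr (\pi_tensor s)) = \pi_tensor s by rewrite reprK.
by rewrite piE => /asboolP ->.
Qed.

Definition tscale_seq (a : R) s : seq (V * W) := [seq (a *: p.1, p.2) | p <- s].

Definition tens_add (x y : tensor) : tensor := \pi_tensor (repr x ++ repr y).
Definition tens_scale (a : R) (x : tensor) : tensor :=
  \pi_tensor (tscale_seq a (repr x)).

Lemma eval_cat P (B : {bilinear V -> W -> P}) s s' :
  tens_eval B (s ++ s') = tens_eval B s + tens_eval B s'.
Proof. by rewrite /tens_eval big_cat. Qed.

Lemma eval_scale P (B : {bilinear V -> W -> P}) a s :
  tens_eval B (tscale_seq a s) = a *: tens_eval B s.
Proof.
rewrite /tens_eval big_map scaler_sumr; apply: eq_bigr => p _ /=.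
by rewrite linearZl_LR.
Qed.

Lemma eval_add P (B : {bilinear V -> W -> P}) x y :
  tens_eval B (repr (tens_add x y)) = tens_eval B (repr x) + tens_eval B (repr y).
Proof. by rewrite tens_eval_pi eval_cat. Qed.

Lemma eval_tscale P (B : {bilinear V -> W -> P}) a x :
  tens_eval B (repr (tens_scale a x)) = a *: tens_eval B (repr x).
Proof. by rewrite tens_eval_pi eval_scale. Qed.

Lemma eval_nil P (B : {bilinear V -> W -> P}) :
  tens_eval B (repr (\pi_tensor [::])) = 0.
Proof. by rewrite tens_eval_pi /tens_eval big_nil. Qed.

Lemma tens_sepP (x y : tensor) :
  (forall P (B : {bilinear V -> W -> P}),
     tens_eval B (repr x) = tens_eval B (repr y)) -> x = y.
Proof. by move=> h; rewrite -[x]reprK -[y]reprK; exact: tens_piP. Qed.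

Fact tens_addA : associative tens_add.
Proof. by move=> x y z; apply: tens_sepP => P B; rewrite !eval_add addrA. Qed.
Fact tens_addC : commutative tens_add.
Proof. by move=> x y; apply: tens_sepP => P B; rewrite !eval_add addrC. Qed.
Fact tens_add0 : left_id (\pi_tensor [::]) tens_add.
Proof.
by move=> x; apply: tens_sepP => P B; rewrite eval_add eval_nil add0r.
Qed.
Fact tens_addN : left_inverse (\pi_tensor [::]) (tens_scale (-1)) tens_add.
Proof.
move=> x; apply: tens_sepP => P B.
by rewrite eval_add eval_tscale scaleN1r addNr eval_nil.
Qed.

HB.instance Definition _ :=
  GRing.isZmodule.Build tensor tens_addA tens_addC tens_add0 tens_addN.

Fact tens_scaleA a b x : tens_scale a (tens_scale b x) = tens_scale (a * b) x.
Proof. by apply: tens_sepP => P B; rewrite !eval_tscale scalerA. Qed.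
Fact tens_scale1 : left_id 1 tens_scale.
Proof. by move=> x; apply: tens_sepP => P B; rewrite eval_tscale scale1r. Qed.
Fact tens_scaleDr : right_distributive tens_scale +%R.
Proof.
move=> a x y; apply: tens_sepP => P B.
by rewrite [in RHS]eval_add !eval_tscale [in LHS]eval_add scalerDr.
Qed.
Fact tens_scaleDl x : {morph tens_scale^~ x : a b / a + b}.
Proof.
move=> a b; apply: tens_sepP => P B.
by rewrite [in RHS]eval_add !eval_tscale scalerDl.
Qed.

HB.instance Definition _ := GRing.Zmodule_isLmodule.Build R tensor
  tens_scaleA tens_scale1 tens_scaleDr tens_scaleDl.

Definition tprod : lmodType R := tensor.

Definition tens (v : V) (w : W) : tprod := \pi_tensor [:: (v, w)].

Definition tlift P (B : {bilinear V -> W -> P}) (x : tprod) : P :=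
  tens_eval B (repr x).

Lemma tliftE P (B : {bilinear V -> W -> P}) v w : tlift B (tens v w) = B v w.
Proof. by rewrite /tlift tens_eval_pi /tens_eval big_seq1. Qed.

Fact tlift_linear P (B : {bilinear V -> W -> P}) : linear (tlift B).
Proof. by move=> a x y; rewrite /tlift eval_add eval_tscale. Qed.
HB.instance Definition _ P (B : {bilinear V -> W -> P}) :=
  GRing.isLinear.Build R tprod P *:%R (tlift B) (tlift_linear B).

Lemma tliftD P (B : {bilinear V -> W -> P}) x y :
  tlift B (x + y) = tlift B x + tlift B y.
Proof. exact: linearD. Qed.

Fact tens_bilinear : bilinear_for *:%R *:%R tens.
Proof.
split=> [w|v] a x y; apply: tens_sepP => P B.
  rewrite eval_add eval_tscale !tens_eval_pi /tens_eval !big_seq1 /=.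
  by rewrite linearPl.
rewrite eval_add eval_tscale !tens_eval_pi /tens_eval !big_seq1 /=.
by rewrite linearPr.
Qed.
HB.instance Definition _ :=
  bilinear_isBilinear.Build R V W tprod *:%R *:%R tens tens_bilinear.

Lemma tensPl w a x y : tens (a *: x + y) w = a *: tens x w + tens y w.
Proof. exact: tens_bilinear.1. Qed.
Lemma tensPr v a x y : tens v (a *: x + y) = a *: tens v x + tens v y.
Proof. exact: tens_bilinear.2. Qed.

Lemma tens_Dl w : {morph tens^~ w : x y / x + y}.
Proof. by move=> x y; have := tensPl w 1 x y; rewrite !scale1r. Qed.
Lemma tens_Dr v : {morph tens v : x y / x + y}.
Proof. by move=> x y; have := tensPr v 1 x y; rewrite !scale1r. Qed.
Lemma tens_0l w : tens 0 w = 0.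
Proof. exact: (linear0l (@tens)). Qed.
Lemma tens_0r v : tens v 0 = 0.
Proof. exact: (linear0r (@tens)). Qed.
Lemma tens_Zl a v w : tens (a *: v) w = a *: tens v w.
Proof. by have := tensPl w a v 0; rewrite tens_0l !addr0. Qed.
Lemma tens_Zr a v w : tens v (a *: w) = a *: tens v w.
Proof. by have := tensPr v a w 0; rewrite tens_0r !addr0. Qed.

Lemma tens_sum (x : tprod) : x = \sum_(p <- repr x) tens p.1 p.2.
Proof.
apply: tens_sepP => P B; rewrite -/(tlift B _) -/(tlift B _).
by rewrite raddf_sum; apply: eq_bigr => p _; rewrite /= tliftE.
Qed.

Lemma tens_ind (Q : tprod -> Prop) :
  (forall v w, Q (tens v w)) -> (forall x y, Q x -> Q y -> Q (x + y)) ->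
  forall x, Q x.
Proof.
move=> Qt QD x; rewrite (tens_sum x).
have Q0 : Q 0 by rewrite -(tens_0l 0); exact: Qt.
by elim: (repr x) => [|p s IH]; rewrite ?big_nil ?big_cons //; apply: QD.
Qed.

Lemma tens_ext P (f g : {linear tprod -> P}) :
  (forall v w, f (tens v w) = g (tens v w)) -> f =1 g.
Proof.
move=> h x; rewrite (tens_sum x) !raddf_sum.
by apply: eq_bigr => p _; exact: h.
Qed.

End TensorProduct.

Notation "V ⊗ W" := (tprod V W)
  (at level 40, left associativity) : type_scope.
Notation "x \ox y" := (tens x y) (at level 40, left associativity) : ring_scope.

Section TensorMaps.
Variable R : comNzRingType.
Implicit Types U V W P : lmodType R.

Section Tmap.
Variables (V V' W W' : lmodType R) (f : {linear V -> V'}) (g : {linear W -> W'}).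

Definition tmap_bil (v : V) (w : W) : V' ⊗ W' := f v \ox g w.
Fact tmap_bilinear : bilinear_for *:%R *:%R tmap_bil.
Proof.
split=> z a x y; rewrite /tmap_bil; first by rewrite [f _]linearP tensPl.
by rewrite [g _]linearP tensPr.
Qed.
HB.instance Definition _ :=
  bilinear_isBilinear.Build R V W (V' ⊗ W') *:%R *:%R tmap_bil tmap_bilinear.

Definition tmap : {linear V ⊗ W -> V' ⊗ W'} := tlift tmap_bil.

Lemma tmapE v w : tmap (v \ox w) = f v \ox g w.
Proof. exact: tliftE. Qed.
End Tmap.

Section Swap.
Variables V W : lmodType R.
Definition tswap_bil (v : V) (w : W) : W ⊗ V := w \ox v.
Fact tswap_bilinear : bilinear_for *:%R *:%R tswap_bil.
Proof. by split=> z a x y; rewrite /tswap_bil ?tensPl ?tensPr. Qed.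
HB.instance Definition _ :=
  bilinear_isBilinear.Build R V W (W ⊗ V) *:%R *:%R tswap_bil tswap_bilinear.
Definition tswap : {linear V ⊗ W -> W ⊗ V} := tlift tswap_bil.
Lemma tswapE v w : tswap (v \ox w) = w \ox v.
Proof. exact: tliftE. Qed.
End Swap.

Section Assoc.
Variables U V W : lmodType R.

Definition tassoc_bil1 (w : W) (u : U) (v : V) : U ⊗ (V ⊗ W) := u \ox (v \ox w).
Fact tassoc_bilinear1 w : bilinear_for *:%R *:%R (tassoc_bil1 w).
Proof.
by split=> z a x y; rewrite /tassoc_bil1 ?tensPl ?tensPr.
Qed.
HB.instance Definition _ w := bilinear_isBilinear.Build R U V
  (U ⊗ (V ⊗ W)) *:%R *:%R (tassoc_bil1 w) (tassoc_bilinear1 w).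

Fact tassoc_bilinear2 u v : linear (fun w => tassoc_bil1 w u v).
Proof. by move=> a x y; rewrite /tassoc_bil1 !tensPr. Qed.

Definition tassoc_bil (t : U ⊗ V) (w : W) : U ⊗ (V ⊗ W) := tlift (tassoc_bil1 w) t.
Fact tassoc_linr z : linear (tassoc_bil z).
Proof.
move=> a x y; rewrite /tassoc_bil; elim/tens_ind: z => [u v|s t IHs IHt].
  by rewrite !tliftE; exact: (tassoc_bilinear2 u v).
by rewrite !tliftD IHs IHt (scalerDr a) addrACA.
Qed.
Fact tassoc_bilinear : bilinear_for *:%R *:%R tassoc_bil.
Proof.
by split=> z; [move=> a x y; rewrite /tassoc_bil linearP | exact: tassoc_linr].
Qed.
HB.instance Definition _ := bilinear_isBilinear.Build R (U ⊗ V) W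
  (U ⊗ (V ⊗ W)) *:%R *:%R tassoc_bil tassoc_bilinear.

Definition tassoc : {linear U ⊗ V ⊗ W -> U ⊗ (V ⊗ W)} := tlift tassoc_bil.

Lemma tassocE u v w : tassoc (u \ox v \ox w) = u \ox (v \ox w).
Proof. by apply: etrans (tliftE _ _ _) _; exact: tliftE. Qed.

Definition tassocV_bil1 (u : U) (v : V) (w : W) : U ⊗ V ⊗ W := u \ox v \ox w.
Fact tassocV_bilinear1 u : bilinear_for *:%R *:%R (tassocV_bil1 u).
Proof.
by split=> z a x y; rewrite /tassocV_bil1 ?tensPr ?tensPl.
Qed.
HB.instance Definition _ u := bilinear_isBilinear.Build R V W
  (U ⊗ V ⊗ W) *:%R *:%R (tassocV_bil1 u) (tassocV_bilinear1 u).

Fact tassocV_bilinear2 v w : linear (fun u => tassocV_bil1 u v w).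
Proof. by move=> a x y; rewrite /tassocV_bil1 !tensPl. Qed.

Definition tassocV_bil (u : U) (t : V ⊗ W) : U ⊗ V ⊗ W := tlift (tassocV_bil1 u) t.
Fact tassocV_linl z : linear (tassocV_bil^~ z).
Proof.
move=> a x y; rewrite /tassocV_bil; elim/tens_ind: z => [u v|s t IHs IHt].
  by rewrite !tliftE; exact: (tassocV_bilinear2 u v).
by rewrite !tliftD IHs IHt (scalerDr a) addrACA.
Qed.
Fact tassocV_bilinear : bilinear_for *:%R *:%R tassocV_bil.
Proof.
by split=> z; [exact: tassocV_linl | move=> a x y; rewrite /tassocV_bil linearP].
Qed.
HB.instance Definition _ := bilinear_isBilinear.Build R U (V ⊗ W)
  (U ⊗ V ⊗ W) *:%R *:%R tassocV_bil tassocV_bilinear.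

Definition tassocV : {linear U ⊗ (V ⊗ W) -> U ⊗ V ⊗ W} := tlift tassocV_bil.

Lemma tassocVE u v w : tassocV (u \ox (v \ox w)) = u \ox v \ox w.
Proof. by apply: etrans (tliftE _ _ _) _; exact: tliftE. Qed.
End Assoc.

Section Interchange.
Variables U V U' V' : lmodType R.

Definition tflip : {linear U ⊗ V ⊗ (U' ⊗ V') -> U ⊗ U' ⊗ (V ⊗ V')} :=
  tassocV _ _ _ \o
  tmap idfun (tassoc _ _ _ \o tmap (tswap _ _) idfun \o tassocV _ _ _) \o
  tassoc _ _ _.

Lemma tflipE u v u' v' :
  tflip ((u \ox v) \ox (u' \ox v')) = (u \ox u') \ox (v \ox v').
Proof.
by rewrite /tflip /= !(tassocE, tmapE, tassocVE, tswapE) /=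
           !(tassocE, tmapE, tassocVE, tswapE).
Qed.
End Interchange.

Section Units.
Variable V : lmodType R.

Definition tunitl_bil (a : R^o) (v : V) : V := a *: v.
Fact tunitl_bilinear : bilinear_for *:%R *:%R tunitl_bil.
Proof.
split=> z a x y; rewrite /tunitl_bil.
  by apply: etrans (scalerDl _ _ _) _; congr (_ + _); exact: esym (scalerA _ _ _).
apply: etrans (scalerDr _ _ _) _; congr (_ + _).
by apply: etrans (scalerA _ _ _) (etrans _ (esym (scalerA _ _ _))); rewrite mulrC.
Qed.
HB.instance Definition _ := bilinear_isBilinear.Build R R^o V V
  *:%R *:%R tunitl_bil tunitl_bilinear.
Definition tunitl : {linear R^o ⊗ V -> V} := tlift tunitl_bil.
Lemma tunitlE a v : tunitl (a \ox v) = a *: v.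
Proof. exact: tliftE. Qed.

Definition tunitr : {linear V ⊗ R^o -> V} := tunitl \o tswap V R^o.
Lemma tunitrE a v : tunitr (v \ox a) = a *: v.
Proof. by rewrite /= tswapE tunitlE. Qed.
End Units.

End TensorMaps.

Arguments tassoc {R U V W}.
Arguments tassocV {R U V W}.
Arguments tflip {R U V U' V'}.
Arguments tunitl {R V}.
Arguments tunitr {R V}.

(* k[t]/(t^{l+1}) and X[t]/(t^{l+1}); the value None of the order l : option nat
   stands for l = oo, in which case nothing is divided out. *)

Section Truncation.
Variable k : comNzRingType.
Implicit Types (l : option nat) (X Y : lmodType k).

Definition le_order (s : nat) l : bool := if l is Some n then (s <= n)%N else true.

Lemma le_order_sub s s' l : (s' <= s)%N -> le_order s l -> le_order s' l.
Proof. by case: l => //= n; exact: leq_trans. Qed.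

Definition trunc_ring l : comNzRingType :=
  if l is Some n then {poly %/ ('X^(n.+1) : {poly k})} else {poly k}.

Definition trunc_poly l : trunc_ring l -> {poly k} :=
  match l return trunc_ring l -> {poly k} with
  | Some n => fun r => val (r : {poly %/ ('X^(n.+1) : {poly k})})
  | None => fun r => r
  end.

Definition trunc_const l (a : k) : trunc_ring l :=
  match l return trunc_ring l with
  | Some n => @qpolyC k 'X^(n.+1) a
  | None => a%:P
  end.

Lemma trunc_polyD l (r r' : trunc_ring l) :
  trunc_poly (r + r') = trunc_poly r + trunc_poly r'.
Proof. by case: l r r'. Qed.

Lemma trunc_poly1 l : trunc_poly (1 : trunc_ring l) = 1.
Proof. by case: l. Qed.

Lemma trunc_poly_const l a : trunc_poly (trunc_const l a) = a%:P.
Proof. by case: l. Qed.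

Lemma trunc_polyM l (r r' : trunc_ring l) s : le_order s l ->
  (trunc_poly (r * r'))`_s = (trunc_poly r * trunc_poly r')`_s.
Proof.
case: l r r' => [n|] //= r r' le_sn.
have mX : ('X^(n.+1) : {poly k}) \is monic by exact: monicXn.
have aux (p : {poly k}) :
    (Pdiv.CommonRing.rmodp p (mk_monic ('X^(n.+1) : {poly k})))`_s = p`_s.
  rewrite mk_monic_Xn /= [in RHS](Pdiv.RingMonic.rdivp_eq mX p).
  by rewrite coefD coefMXn ltnS le_sn add0r.
exact: aux.
Qed.

(* The sequence of coefficients of an element of X[t]/(t^{l+1}). *)
Definition trunc_pred l X (u : nat -> X) : bool :=
  `[< (exists N, forall s, (N <= s)%N -> u s = 0) /\
      (forall s, ~~ le_order s l -> u s = 0) >].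

Record tpoly l X := TPoly { tcoef :> nat -> X; tcoefP : trunc_pred l tcoef }.
HB.instance Definition _ l X := [isSub for @tcoef l X].
HB.instance Definition _ l X := [Choice of tpoly l X by <:].

Fact trunc_zmod_closed l X : zmod_closed (@trunc_pred l X).
Proof.
split=> [|u v]; first by apply/asboolP; split=> //; exists 0%N.
move=> /asboolP[[N uN] ul] /asboolP[[M vM] vl]; apply/asboolP; split.
  exists (maxn N M) => s; rewrite geq_max => /andP[Ns Ms].
  by rewrite !fctE uN // vM // subr0.
by move=> s sl; rewrite !fctE ul // vl // subr0.
Qed.
HB.instance Definition _ l X := GRing.isZmodClosed.Build (nat -> X)
  (@trunc_pred l X) (@trunc_zmod_closed l X).
HB.instance Definition _ l X := [SubChoice_isSubZmodule of tpoly l X by <:].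

Lemma tcoefD l X (u v : tpoly l X) s : (u + v) s = u s + v s.
Proof. by []. Qed.

Lemma tpolyP l X (u v : tpoly l X) : (forall s, u s = v s) -> u = v.
Proof. by move=> uv; apply: val_inj; apply/funext. Qed.

Lemma tcoef_gt l X (u : tpoly l X) s : ~~ le_order s l -> u s = 0.
Proof. by case: u => u /= /asboolP[_]; exact. Qed.

(* Cauchy product along a biadditive map op. *)
Definition cauchy l (A B C : zmodType) (op : A -> B -> C) (a : nat -> A)
    (b : nat -> B) (s : nat) : C :=
  if le_order s l then \sum_(i < s.+1) op (a i) (b (s - i)%N) else 0.

Lemma cauchy_fin l (A B : zmodType) X (op : A -> B -> X) a b :
  (forall y, op 0 y = 0) -> (forall x, op x 0 = 0) ->
  (exists N, forall s, (N <= s)%N -> a s = 0) ->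
  (exists N, forall s, (N <= s)%N -> b s = 0) ->
  trunc_pred l (cauchy l op a b).
Proof.
move=> op0 op0' [N aN] [M bM]; apply/asboolP; split; last first.
  by move=> s /negPf sl; rewrite /cauchy sl.
exists (N + M)%N => s NMs; rewrite /cauchy; case: ifP => // _.
apply: big1 => i _; case: (leqP N i) => [Ni|iN]; first by rewrite aN // op0.
rewrite bM ?op0' // leq_subRL; first by rewrite (leq_trans _ NMs) // leq_add2r ltnW.
by rewrite -ltnS ltn_ord.
Qed.

Lemma sum_ord_ge (Z : zmodType) (G : nat -> Z) n j : (j <= n)%N ->
  \sum_(i < n.+1 | (j < i.+1)%N) G i = \sum_(i < (n - j).+1) G (j + i)%N.
Proof.
move=> jn; rewrite -(big_mkord (fun i => (j < i.+1)%N) G).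
rewrite (@big_cat_nat _ _ _ j) //=; last by rewrite leqW.
rewrite [X in X + _]big_nat_cond big1 ?add0r; last first.
  by move=> i /andP[/andP[_ ij]]; rewrite ltnS leqNgt ij.
rewrite -subSn // -(big_mkord xpredT (fun i => G (j + i)%N)).
rewrite -[in LHS](add0n j) big_addn add0n big_nat_cond [RHS]big_nat_cond.
apply: eq_big => [i|i _]; last by rewrite addnC.
by rewrite ltnS leq_addl andbT.
Qed.

Lemma sum_triangle (Z : zmodType) (F : nat -> nat -> nat -> Z) n :
  \sum_(i < n.+1) \sum_(j < i.+1) F j (i - j)%N (n - i)%N =
  \sum_(i < n.+1) \sum_(j < (n - i).+1) F i j (n - i - j)%N.
Proof.
under eq_bigr => i _ do
  rewrite (big_ord_widen n.+1 (fun j => F j (i - j)%N (n - i)%N)) //.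
rewrite (exchange_big_dep xpredT) //=; apply: eq_bigr => j _.
rewrite (sum_ord_ge (fun i => F j (i - j)%N (n - i)%N)) -1?ltnS //.
by apply: eq_bigr => i _; rewrite addKn subnDA.
Qed.

Lemma cauchyA l (A B C D E Z : zmodType) (op1 : A -> B -> D) (op2 : D -> C -> Z)
    (op3 : B -> C -> E) (op4 : A -> E -> Z) a b c s :
  (forall z, {morph op2^~ z : x y / x + y}) -> (forall z, op2 0 z = 0) ->
  (forall x, {morph op4 x : y z / y + z}) -> (forall x, op4 x 0 = 0) ->
  (forall x y z, op2 (op1 x y) z = op4 x (op3 y z)) ->
  cauchy l op2 (cauchy l op1 a b) c s = cauchy l op4 a (cauchy l op3 b c) s.
Proof.
move=> D2 Z2 D4 Z4 e; rewrite /cauchy; case: ifP => // sl.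
transitivity (\sum_(i < s.+1) \sum_(j < i.+1)
    op2 (op1 (a j) (b (i - j)%N)) (c (s - i)%N)).
  apply: eq_bigr => i _; rewrite (le_order_sub _ sl) -1?ltnS //.
  by rewrite (big_morph (op2^~ _) (D2 _) (Z2 _)).
rewrite (sum_triangle (fun i j m => op2 (op1 (a i) (b j)) (c m))).
apply: eq_bigr => i _; rewrite (le_order_sub _ sl) ?leq_subr //.
rewrite (big_morph (op4 _) (D4 _) (Z4 _)).
by apply: eq_bigr => j _; rewrite e.
Qed.

Lemma cauchyC l (A B C : zmodType) (op : A -> B -> C) a b s :
  cauchy l op a b s = cauchy l (fun y x => op x y) b a s.
Proof.
rewrite /cauchy; case: ifP => // _; rewrite (reindex_inj rev_ord_inj) /=.
by apply: eq_bigr => i _; rewrite subSS subKn // -ltnS.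
Qed.

Lemma cauchy_linl l (A B C : zmodType) (op : A -> B -> C) a a' b s :
  (forall y, {morph op^~ y : x x' / x + x'}) ->
  cauchy l op (fun i => a i + a' i) b s = cauchy l op a b s + cauchy l op a' b s.
Proof.
move=> D; rewrite /cauchy; case: ifP => [_|]; last by rewrite addr0.
by rewrite -big_split; apply: eq_bigr => i _; rewrite D.
Qed.

Lemma eq_cauchy l (A B C : zmodType) (op : A -> B -> C) a a' b b' s :
  (forall i, le_order i l -> a i = a' i) -> (forall i, le_order i l -> b i = b' i) ->
  cauchy l op a b s = cauchy l op a' b' s.
Proof.
move=> aa bb; rewrite /cauchy; case: ifP => // sl; apply: eq_bigr => i _.
by rewrite aa ?bb ?(le_order_sub _ sl) ?leq_subr // -ltnS.
Qed.

Lemma trunc_pred_fin l X (u : tpoly l X) :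
  exists N, forall s, (N <= s)%N -> u s = 0.
Proof. by case: u => u /= /asboolP[]. Qed.

Lemma poly_fin (p : {poly k}) : exists N, forall s, (N <= s)%N -> p`_s = 0.
Proof. by exists (size p) => s; exact: nth_default. Qed.

Section TpolyModule.
Variables (l : option nat) (X : lmodType k).
Implicit Types (r : trunc_ring l) (u : tpoly l X).

Definition kscale (a : k) (x : X) : X := a *: x.

Fact tscale_subproof r u :
  trunc_pred l (cauchy l kscale (fun i => (trunc_poly r)`_i) u).
Proof.
apply: cauchy_fin; [exact: scale0r|exact: scaler0|exact: poly_fin|].
exact: trunc_pred_fin.
Qed.

Definition tscale r u : tpoly l X := TPoly (tscale_subproof r u).

Fact tscaleA r r' u : tscale r (tscale r' u) = tscale (r * r') u.
Proof.
apply: tpolyP => s /=; rewrite -(@cauchyA _ _ _ _ _ _ _ *%R kscale).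
- apply: eq_cauchy => // i il; rewrite trunc_polyM // coefM.
  by rewrite /cauchy il.
- by move=> x a b; exact: scalerDl.
- by move=> x; exact: scale0r.
- by move=> a x y; exact: scalerDr.
- by move=> a; exact: scaler0.
- by move=> a b x; rewrite /kscale scalerA.
Qed.

Fact tscale1 : left_id 1 tscale.
Proof.
move=> u; apply: tpolyP => s /=; rewrite /cauchy; case: ifPn => [sl|/tcoef_gt->//].
rewrite big_ord_recl trunc_poly1 big1 ?addr0 => [|i _].
  by rewrite coef1 eqxx subn0 /kscale scale1r.
by rewrite coef1 /kscale scale0r.
Qed.

Fact tscaleDr : right_distributive tscale +%R.
Proof.
move=> r u v; apply: tpolyP => s; rewrite tcoefD /=.
rewrite ![cauchy l kscale _ _ s]cauchyC.
by apply: cauchy_linl => a x y; exact: scalerDr.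
Qed.

Fact tscaleDl u : {morph tscale^~ u : r r' / r + r'}.
Proof.
move=> r r'; apply: tpolyP => s; rewrite tcoefD /=.
rewrite -cauchy_linl; last by move=> x a b; exact: scalerDl.
by apply: eq_cauchy => // i _; rewrite trunc_polyD coefD.
Qed.

HB.instance Definition _ := GRing.Zmodule_isLmodule.Build (trunc_ring l)
  (tpoly l X) tscaleA tscale1 tscaleDr tscaleDl.

(* X[t]/(t^{l+1}) as a module over k[t]/(t^{l+1}). *)
Definition texp : lmodType (trunc_ring l) := tpoly l X.

Lemma tscaleE r (u : texp) s : (r *: u) s =
  if le_order s l then \sum_(i < s.+1) (trunc_poly r)`_i *: u (s - i)%N else 0.
Proof. by []. Qed.

Fact tconst_subproof (x : X) : trunc_pred l (fun s => if s == 0%N then x else 0).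
Proof.
apply/asboolP; split; first by exists 1%N => -[].
by case: l => [n|] [].
Qed.

Definition tconst (x : X) : texp := TPoly (tconst_subproof x).

Lemma tconst_lin a x y :
  tconst (a *: x + y) = trunc_const l a *: tconst x + tconst y.
Proof.
apply: tpolyP => s; rewrite tcoefD tscaleE trunc_poly_const.
case: s => [|s] /=.
  rewrite (_ : le_order 0 l = true); last by case: (l).
  by rewrite big_ord_recl big_ord0 coefC /= addr0.
case: ifP => _; rewrite ?addr0 // big1 ?addr0 // => i _.
rewrite coefC; case: eqP => [->|_]; last by rewrite scale0r.
by rewrite subn0 scaler0.
Qed.

Lemma trunc_const_scale a (u : texp) s : (trunc_const l a *: u) s = a *: u s.
Proof.
rewrite tscaleE trunc_poly_const; case: ifPn => [_|/tcoef_gt->]; last by rewrite scaler0.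
rewrite big_ord_recl big1 ?addr0 => [|i _]; last by rewrite coefC scale0r.
by rewrite coefC eqxx subn0.
Qed.

End TpolyModule.

Section Coefficients.
Variables (l : option nat) (X Y : lmodType k) (f : {linear texp l X -> texp l Y}).

(* f = sum_s f_s t^s on X; dcoef s is f_s. *)
Definition dcoef_fun s (x : X) : Y := f (tconst l x) s.
Fact dcoef_linear s : linear (dcoef_fun s).
Proof.
by move=> a x y; rewrite /dcoef_fun tconst_lin linearP tcoefD trunc_const_scale.
Qed.
HB.instance Definition _ s :=
  GRing.isLinear.Build k X Y *:%R (dcoef_fun s) (dcoef_linear s).
Definition dcoef s : {linear X -> Y} := dcoef_fun s.

End Coefficients.

Section ExtensionOfScalars.
Variables (l : option nat) (X Y : lmodType k).

Fact tconv_subproof (u : texp l X) (v : texp l Y) :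
  trunc_pred l (cauchy l (@tens k X Y) u v).
Proof.
apply: cauchy_fin; try exact: trunc_pred_fin.
- by move=> y; exact: tens_0l.
- by move=> x; exact: tens_0r.
Qed.

Definition tconv (u : texp l X) (v : texp l Y) : texp l (X ⊗ Y) :=
  TPoly (tconv_subproof u v).

Fact tconv_bilinear : bilinear_for *:%R *:%R tconv.
Proof.
split=> w r u v; apply: tpolyP => s; rewrite tcoefD /=.
  rewrite cauchy_linl; last exact: tens_Dl.
  congr (_ + _); apply: cauchyA.
  - exact: tens_Dl.
  - by move=> y; exact: tens_0l.
  - by move=> a x y; exact: scalerDr.
  - by move=> a; exact: scaler0.
  - by move=> a x y; exact: tens_Zl.
rewrite cauchyC cauchy_linl; last by move=> x y y'; exact: tens_Dr.
congr (_ + _); last by rewrite cauchyC.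
rewrite (@cauchyA _ _ _ _ _ _ _ _ _ (fun y x => x \ox y) (fun a z => a *: z)).
- by apply: eq_cauchy => // i _; rewrite [RHS]cauchyC.
- by move=> x y y'; exact: tens_Dr.
- by move=> x; exact: tens_0r.
- by move=> a x y; exact: scalerDr.
- by move=> a; exact: scaler0.
- by move=> a y x; exact: tens_Zr.
Qed.
HB.instance Definition _ := bilinear_isBilinear.Build (trunc_ring l)
  (texp l X) (texp l Y) (texp l (X ⊗ Y)) *:%R *:%R tconv tconv_bilinear.

(* The canonical identification of the tensor product over k[t]/(t^{l+1})
   of X[t]/(t^{l+1}) and Y[t]/(t^{l+1}) with (X ⊗ Y)[t]/(t^{l+1}). *)
Definition tident : {linear texp l X ⊗ texp l Y -> texp l (X ⊗ Y)} := tlift tconv.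

Lemma tidentE u v s : tident (u \ox v) s =
  if le_order s l then \sum_(i < s.+1) u i \ox v (s - i)%N else 0.
Proof. exact: (congr1 (fun z : tpoly l (X ⊗ Y) => z s) (tliftE _ _ _)). Qed.

End ExtensionOfScalars.

End Truncation.

Arguments tident {k l X Y}.

Section IdentificationBijective.
Variables (k : comNzRingType) (l : option nat).

Fact trunc_constD (a b : k) :
  trunc_const l (a + b) = trunc_const l a + trunc_const l b.
Proof. by case: l => [n|]; [apply: val_inj; exact: polyCD | exact: polyCD]. Qed.

Fact trunc_constM (a b : k) :
  trunc_const l (a * b) = trunc_const l a * trunc_const l b.
Proof.
case: l => [n|]; last exact: polyCM.
apply: val_inj; rewrite /= -polyCM Pdiv.CommonRing.rmodp_small //.
by rewrite (leq_ltn_trans (size_polyC_leq1 _)) // size_mk_monic_gt1.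
Qed.

Fact trunc_const1 : trunc_const l (1 : k) = 1.
Proof. by case: l => [n|] //; apply: val_inj. Qed.

(* Restriction of scalars to k. *)
Definition restr (M : lmodType (trunc_ring k l)) : Type := M.
HB.instance Definition _ M := GRing.Zmodule.on (restr M).

Section Restr.
Variable M : lmodType (trunc_ring k l).
Definition restr_scale (a : k) (x : restr M) : restr M :=
  trunc_const l a *: (x : M).
Fact restr_scaleA a b x :
  restr_scale a (restr_scale b x) = restr_scale (a * b) x.
Proof. by rewrite /restr_scale trunc_constM scalerA. Qed.
Fact restr_scale1 : left_id 1 restr_scale.
Proof. by move=> x; rewrite /restr_scale trunc_const1 scale1r. Qed.
Fact restr_scaleDr : right_distributive restr_scale +%R.
Proof. by move=> a x y; exact: scalerDr. Qed.
Fact restr_scaleDl x : {morph restr_scale^~ x : a b / a + b}.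
Proof. by move=> a b; rewrite /restr_scale trunc_constD; exact: scalerDl. Qed.
HB.instance Definition _ := GRing.Zmodule_isLmodule.Build k (restr M)
  restr_scaleA restr_scale1 restr_scaleDr restr_scaleDl.
End Restr.

Definition trunc_Xn (s : nat) : trunc_ring k l :=
  match l return trunc_ring k l with
  | Some n => in_qpoly ('X^(n.+1) : {poly k}) 'X^s
  | None => 'X^s
  end.

Lemma trunc_XnD s s' : trunc_Xn (s + s') = trunc_Xn s * trunc_Xn s'.
Proof. by rewrite /trunc_Xn; case: l => [n|]; rewrite exprD ?in_qpolyM. Qed.

Lemma trunc_Xn_eq0 s : ~~ le_order s l -> trunc_Xn s = 0.
Proof.
rewrite /trunc_Xn; case: l => [n|] //=; rewrite -ltnNge => ns; apply: val_inj.
rewrite /= mk_monic_Xn /= -(subnK ns) exprD.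
exact/Pdiv.RingMonic.rmodp_mull/monicXn.
Qed.

Lemma coef_trunc_Xn s i : le_order i l -> (trunc_poly (trunc_Xn s))`_i = (i == s)%:R.
Proof.
rewrite /trunc_Xn /trunc_poly; case: l => [n|] /= il; last by rewrite coefXn.
case: (leqP s n) => sn.
  rewrite Pdiv.CommonRing.rmodp_small ?coefXn //.
  by rewrite mk_monic_Xn /= !size_polyXn.
rewrite mk_monic_Xn /= -{1}(subnK sn) exprD Pdiv.RingMonic.rmodp_mull.
  by rewrite coef0 ltn_eqF // (leq_ltn_trans il).
exact: monicXn.
Qed.

Lemma texp_expand (X : lmodType k) (u : texp l X) N :
  (forall s, (N <= s)%N -> u s = 0) ->
  u = \sum_(i < N) trunc_Xn i *: tconst l (u i).
Proof.
move=> uN; apply: tpolyP => s.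
have -> : forall F : 'I_N -> texp l X, (\sum_i F i) s = \sum_i F i s.
  by move=> F; elim/big_rec2: _ => //= i x y _ <-.
have E i : (trunc_Xn i *: tconst l (u i)) s = if s == i then u s else 0.
  rewrite tscaleE; case: ifPn => sl; last by rewrite tcoef_gt //; case: ifP.
  rewrite big_ord_recr /= big1 ?add0r => [|j _]; last first.
    by rewrite subn_eq0 leqNgt ltn_ord scaler0.
  rewrite subnn eqxx coef_trunc_Xn //.
  by case: eqP => [->|_]; rewrite ?scale1r ?scale0r.
under eq_bigr => i _ do rewrite E.
case: (leqP N s) => [Ns|sN].
  by rewrite uN // big1 // => i _; case: ifP.
rewrite (bigD1 (Ordinal sN)) //= eqxx big1 ?addr0 // => i /negPf.
by rewrite -val_eqE /= eq_sym => ->.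
Qed.

Section Bij.
Variables X Y : lmodType k.
Local Notation M := (texp l X ⊗ texp l Y).

Definition tconst2 (x : X) (y : Y) : restr M := tconst l x \ox tconst l y.
Fact tconst2_bilinear : bilinear_for *:%R *:%R tconst2.
Proof.
split=> z a x y; rewrite /tconst2 tconst_lin; first exact: tensPl.
exact: tensPr.
Qed.
HB.instance Definition _ := bilinear_isBilinear.Build k X Y (restr M)
  *:%R *:%R tconst2 tconst2_bilinear.

Definition tident_inv0 (z : X ⊗ Y) : M := tlift tconst2 z.
Lemma tident_inv0D z z' :
  tident_inv0 (z + z') = tident_inv0 z + tident_inv0 z'.
Proof. exact: (tliftD tconst2 z z'). Qed.
Lemma tident_inv00 : tident_inv0 0 = 0.
Proof. exact: (linear0 (tlift tconst2)). Qed.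

Lemma tident_inv0K z : tident (tident_inv0 z) = tconst l z.
Proof.
elim/tens_ind: z => [x y|z z' IH IH']; last first.
  rewrite tident_inv0D linearD IH IH'.
  by have := tconst_lin l 1 z z'; rewrite trunc_const1 !scale1r => ->.
rewrite /tident_inv0 tliftE; apply: tpolyP => s; rewrite tidentE.
case: ifPn => [sl|/tcoef_gt->//].
rewrite big_ord_recl big1 ?addr0 /= => [|i _]; last exact: tens_0l.
by rewrite subn0; case: eqP => // _; exact: tens_0r.
Qed.

Lemma tident_surj (w : texp l (X ⊗ Y)) : exists z, tident z = w.
Proof.
have [N wN] := trunc_pred_fin w.
exists (\sum_(i < N) trunc_Xn i *: tident_inv0 (w i)).
rewrite [RHS](texp_expand wN) raddf_sum; apply: eq_bigr => i _.
by rewrite /= linearZ_LR /= tident_inv0K.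
Qed.

Lemma tident_recover (z : M) : exists N0, forall N, (N0 <= N)%N ->
  z = \sum_(i < N.+1) trunc_Xn i *: tident_inv0 (tident z i).
Proof.
elim/tens_ind: z => [u v|z z' [N zN] [N' zN']]; last first.
  exists (maxn N N') => n; rewrite geq_max => /andP[Nn N'n].
  rewrite [in LHS](zN n) // [in LHS](zN' n) // -big_split; apply: eq_bigr => i _.
  by rewrite linearD tcoefD tident_inv0D scalerDr.
have [[N uN] [N' vN]] := (trunc_pred_fin u, trunc_pred_fin v).
exists (N + N')%N => n Nn.
pose F a b : M := (trunc_Xn a *: tconst l (u a)) \ox (trunc_Xn b *: tconst l (v b)).
have tc0 (Z : lmodType k) : tconst l (0 : Z) = 0.
  by apply: tpolyP => s /=; case: ifP.
transitivity (\sum_(i < n.+1) \sum_(j < i.+1) F j (i - j)%N); last first.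
  apply: eq_bigr => i _; rewrite tidentE; case: ifPn => il; last first.
    rewrite trunc_Xn_eq0 // scale0r big1 // => j _.
    rewrite /F tens_Zl tens_Zr scalerA -trunc_XnD subnKC -1?ltnS //.
    by rewrite trunc_Xn_eq0 // scale0r.
  rewrite (big_morph _ tident_inv0D tident_inv00) scaler_sumr.
  apply: eq_bigr => j _; rewrite /F tens_Zl tens_Zr scalerA -trunc_XnD.
  by rewrite subnKC -1?ltnS // /tident_inv0 tliftE.
rewrite (sum_triangle (fun a b _ => F a b)).
have un s : (n.+1 <= s)%N -> u s = 0.
  by move=> ns; rewrite uN // (leq_trans _ (ltnW ns)) // (leq_trans _ Nn) ?leq_addr.
rewrite [in LHS](texp_expand un).
rewrite (big_morph (fun x => x \ox v) (@tens_Dl _ _ _ v) (@tens_0l _ _ _ v)).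
apply: eq_bigr => a _; case: (leqP N a) => aN.
  by rewrite uN // tc0 scaler0 big1 ?tens_0l // => j _;
     rewrite /F uN // tc0 scaler0 tens_0l.
have vn s : ((n - a).+1 <= s)%N -> v s = 0.
  move=> ns; rewrite vN // (leq_trans _ (ltnW ns)) // leq_subRL; last first.
    by rewrite -ltnS.
  by rewrite (leq_trans _ Nn) // leq_add2r ltnW.
rewrite [in LHS](texp_expand vn).
exact: (big_morph (fun y => _ \ox y) (@tens_Dr _ _ _ _) (@tens_0r _ _ _ _)).
Qed.

Lemma tident_bij : bijective (@tident k l X Y).
Proof.
have inj : injective (@tident k l X Y).
  move=> z z' zz'; have [[N zN] [N' zN']] := (tident_recover z, tident_recover z').
  by rewrite (zN _ (leq_maxl N N')) (zN' _ (leq_maxr N N')) zz'.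
have [g gK] := choice tident_surj.
by exists g => // z; apply: inj; rewrite gK.
Qed.

End Bij.
End IdentificationBijective.

Section AlgebraicStructures.
Variable R : comNzRingType.

(* Multiplication of the tensor product of two algebras. *)
Definition tens_mul (A B : lmodType R) (mA : {linear A ⊗ A -> A})
    (mB : {linear B ⊗ B -> B}) : {linear A ⊗ B ⊗ (A ⊗ B) -> A ⊗ B} :=
  tmap mA mB \o tflip.

Record algebra_on (A : lmodType R) := AlgebraOn {
  amul : {linear A ⊗ A -> A};
  aone : A;
  amulA : forall x y z, amul (amul (x \ox y) \ox z) = amul (x \ox amul (y \ox z));
  amul1l : forall x, amul (aone \ox x) = x;
  amul1r : forall x, amul (x \ox aone) = x
}.

Record coalgebra_on (C : lmodType R) := CoalgebraOn {
  comul : {linear C -> C ⊗ C};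
  counit : {linear C -> R^o};
  comulA : forall x,
    tassoc (tmap comul idfun (comul x)) = tmap idfun comul (comul x);
  comul1l : forall x, tunitl (tmap counit idfun (comul x)) = x;
  comul1r : forall x, tunitr (tmap idfun counit (comul x)) = x
}.

Record bialgebra_on (H : lmodType R) := BialgebraOn {
  bialg :> algebra_on H;
  bicoalg :> coalgebra_on H;
  comulM : forall x y, comul bicoalg (amul bialg (x \ox y)) =
    tens_mul (amul bialg) (amul bialg) (comul bicoalg x \ox comul bicoalg y);
  comul1 : comul bicoalg (aone bialg) = aone bialg \ox aone bialg;
  counitM : forall x y, counit bicoalg (amul bialg (x \ox y)) =
    counit bicoalg x * counit bicoalg y;
  counit1 : counit bicoalg (aone bialg) = 1
}.

Record hopf_on (H : lmodType R) := HopfOn {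
  hopf_bialg :> bialgebra_on H;
  antipode : {linear H -> H};
  antipodel : forall x,
    amul hopf_bialg (tmap antipode idfun (comul hopf_bialg x)) =
    counit hopf_bialg x *: aone hopf_bialg;
  antipoder : forall x,
    amul hopf_bialg (tmap idfun antipode (comul hopf_bialg x)) =
    counit hopf_bialg x *: aone hopf_bialg
}.

Record comodule_algebra_on (H : lmodType R) (h : bialgebra_on H)
    (A : lmodType R) := ComoduleAlgebraOn {
  coalg_alg :> algebra_on A;
  coact : {linear A -> H ⊗ A};
  coactA : forall a,
    tassoc (tmap (comul h) idfun (coact a)) = tmap idfun coact (coact a);
  coact_counit : forall a, tunitl (tmap (counit h) idfun (coact a)) = a;
  coactM : forall a b, coact (amul coalg_alg (a \ox b)) =
    tens_mul (amul h) (amul coalg_alg) (coact a \ox coact b);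
  coact1 : coact (aone coalg_alg) = aone h \ox aone coalg_alg
}.

(* A grading V = V(0) + ... + V(m) (direct sum), with V(n) = 0 for n > m. *)
Record grading (V : lmodType R) (m : nat) := Grading {
  homog :> nat -> V -> Prop;
  homog_lin : forall n a x y, homog n x -> homog n y -> homog n (a *: x + y);
  homog_sum : forall x, exists! f : {ffun 'I_m.+1 -> V},
    (forall i : 'I_m.+1, homog i (f i)) /\ x = \sum_i f i;
  homog_gt : forall n x, (m < n)%N -> homog n x <-> x = 0
}.

(* The degree n part of V ⊗ W, the sum of the V(i) ⊗ W(n - i). *)
Definition tens_homog (V W : lmodType R) (gV : nat -> V -> Prop)
    (gW : nat -> W -> Prop) (n : nat) (z : V ⊗ W) : Prop :=
  exists2 s : seq (V * W),
    forall p, p \in s -> exists2 i, (i <= n)%N & gV i p.1 /\ gW (n - i)%N p.2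
  & z = \sum_(p <- s) p.1 \ox p.2.

Definition degree0 (V W : Type) (gV : nat -> V -> Prop) (gW : nat -> W -> Prop)
    (f : V -> W) : Prop :=
  forall n x, gV n x -> gW n (f x).

Definition graded_algebra (A : lmodType R) (a : algebra_on A)
    (gA : nat -> A -> Prop) : Prop :=
  degree0 (tens_homog gA gA) gA (amul a) /\ gA 0%N (aone a).

Record graded_hopf (H : lmodType R) (h : hopf_on H) (gH : nat -> H -> Prop) :
    Prop := GradedHopf {
  graded_hopf_alg : graded_algebra h gH;
  graded_comul : degree0 gH (tens_homog gH gH) (comul h);
  graded_counit : forall n x, (0 < n)%N -> gH n x -> counit h x = 0;
  graded_antipode : degree0 gH gH (antipode h)
}.

Record graded_comodule_algebra (H : lmodType R) (h : bialgebra_on H)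
    (gH : nat -> H -> Prop) (A : lmodType R) (a : comodule_algebra_on h A)
    (gA : nat -> A -> Prop) : Prop := GradedComoduleAlgebra {
  graded_coalg_alg : graded_algebra a gA;
  graded_coact : degree0 gA (tens_homog gH gA) (coact a)
}.

End AlgebraicStructures.

Section Deformations.
Variable k : fieldType.

(* The grading of X[t]/(t^{l+1}) for which t has degree 1: the coefficient of
   t^s in a homogeneous element of degree n has degree n - s. *)
Definition texp_homog (l : option nat) (X : lmodType k) (gX : nat -> X -> Prop)
    (n : nat) (u : texp l X) : Prop :=
  forall s, if (s <= n)%N then gX (n - s)%N (u s) else u s = 0.

(* The maps m^l = def_mul and Delta^l = def_comul make H[t]/(t^{l+1}) a bialgebra
   over k[t]/(t^{l+1}) through the bijection tident, see tident_bij; unit and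
   counit are only required to exist. *)
Record deformation (H : lmodType k) (h : bialgebra_on H)
    (gH : nat -> H -> Prop) (l : option nat) := Deformation {
  def_bialg :> bialgebra_on (texp l H);
  def_mul : {linear texp l (H ⊗ H) -> texp l H};
  def_comul : {linear texp l H -> texp l (H ⊗ H)};
  def_mulE : forall z, amul def_bialg z = def_mul (tident z);
  def_comulE : forall u, tident (comul def_bialg u) = def_comul u;
  def_mul_deg : degree0 (texp_homog (tens_homog gH gH)) (texp_homog gH) def_mul;
  def_comul_deg :
    degree0 (texp_homog gH) (texp_homog (tens_homog gH gH)) def_comul;
  def_mul0 : dcoef def_mul 0 =1 amul h;
  def_comul0 : dcoef def_comul 0 =1 comul h
}.

Record comodule_deformation (H : lmodType k) (h : bialgebra_on H)
    (gH : nat -> H -> Prop) (l : option nat) (D : deformation h gH l)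
    (G : lmodType k) (g : comodule_algebra_on h G) (gG : nat -> G -> Prop) :=
    ComoduleDeformation {
  def_coalg :> comodule_algebra_on D (texp l G);
  def_amul : {linear texp l (G ⊗ G) -> texp l G};
  def_coact : {linear texp l G -> texp l (H ⊗ G)};
  def_amulE : forall z, amul def_coalg z = def_amul (tident z);
  def_coactE : forall u, tident (coact def_coalg u) = def_coact u;
  def_amul_deg : degree0 (texp_homog (tens_homog gG gG)) (texp_homog gG) def_amul;
  def_coact_deg :
    degree0 (texp_homog gG) (texp_homog (tens_homog gH gG)) def_coact;
  def_amul0 : dcoef def_amul 0 =1 amul g;
  def_coact0 : dcoef def_coact 0 =1 coact g
}.

End Deformations.

Section TensorPowers.
Variables (R : comNzRingType).

(* tpow1 V n is V ⊗ (V ⊗ (... ⊗ V)) with n + 1 factors. *)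
Fixpoint tpow1 (V : lmodType R) (n : nat) : lmodType R :=
  if n is n'.+1 then V ⊗ tpow1 V n' else V.

Definition tpow (V : lmodType R) (n : nat) : lmodType R :=
  if n is n'.+1 then tpow1 V n' else R^o.

(* The associativity identification V^{⊗ n+2} = V^{⊗ n+1} ⊗ V, in both directions. *)
Fixpoint split_last (V : lmodType R) n :
    {linear tpow1 V n.+1 -> tpow1 V n ⊗ V} :=
  match n return {linear tpow1 V n.+1 -> tpow1 V n ⊗ V} with
  | 0 => idfun
  | n'.+1 => tassocV \o tmap idfun (split_last V n')
  end.

Fixpoint join_last (V : lmodType R) n :
    {linear tpow1 V n ⊗ V -> tpow1 V n.+1} :=
  match n return {linear tpow1 V n ⊗ V -> tpow1 V n.+1} with
  | 0 => idfun
  | n'.+1 => tmap idfun (join_last V n') \o tassoc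
  end.

(* Multiplication of the factors number i + 1 and i + 2 of A^{⊗ n+2};
   the value when i > n is irrelevant. *)
Fixpoint mul_at (A : lmodType R) (m : {linear A ⊗ A -> A}) i n :
    {linear tpow1 A n.+1 -> tpow1 A n} :=
  match i, n return {linear tpow1 A n.+1 -> tpow1 A n} with
  | 0, 0 => m
  | 0, n'.+1 => tmap m idfun \o tassocV
  | i'.+1, 0 => \0
  | i'.+1, n'.+1 => tmap idfun (mul_at m i' n')
  end.

(* Comultiplication of the factor number i + 1 of H^{⊗ n+1};
   the value when i > n is irrelevant. *)
Fixpoint comul_at (H : lmodType R) (D : {linear H -> H ⊗ H}) i n :
    {linear tpow1 H n -> tpow1 H n.+1} :=
  match i, n return {linear tpow1 H n -> tpow1 H n.+1} with
  | 0, 0 => D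
  | 0, n'.+1 => tassoc \o tmap D idfun
  | i'.+1, 0 => \0
  | i'.+1, n'.+1 => tmap idfun (comul_at D i' n')
  end.

End TensorPowers.

Section DiagonalMaps.
Variables (R : comNzRingType) (H : lmodType R) (h : bialgebra_on H).
Local Notation mH := (amul h).
Local Notation DH := (comul h).

(* x ⊗ (y^1 ⊗ ... ⊗ y^s) |-> x_(1) y^1 ⊗ ... ⊗ x_(s) y^s, with s = n + 1. *)
Fixpoint lact n : {linear H ⊗ tpow1 H n -> tpow1 H n} :=
  match n return {linear H ⊗ tpow1 H n -> tpow1 H n} with
  | 0 => mH
  | n'.+1 => tmap mH (lact n') \o tflip \o tmap DH idfun
  end.

(* (y^1 ⊗ ... ⊗ y^s) ⊗ x |-> y^1 x_(1) ⊗ ... ⊗ y^s x_(s), with s = n + 1. *)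
Fixpoint ract n : {linear tpow1 H n ⊗ H -> tpow1 H n} :=
  match n return {linear tpow1 H n ⊗ H -> tpow1 H n} with
  | 0 => mH
  | n'.+1 => tmap mH (ract n') \o tflip \o tmap idfun DH
  end.

Section Coaction.
Variables (A : lmodType R) (mA : {linear A ⊗ A -> A}) (r : {linear A -> H ⊗ A}).

(* a^1 ⊗ ... ⊗ a^s |-> a^1_(-1) ... a^s_(-1) ⊗ (a^1_(0) ⊗ ... ⊗ a^s_(0)),
   with s = n + 1. *)
Fixpoint lcoact n : {linear tpow1 A n -> H ⊗ tpow1 A n} :=
  match n return {linear tpow1 A n -> H ⊗ tpow1 A n} with
  | 0 => r
  | n'.+1 => tmap mH idfun \o tflip \o tmap r (lcoact n')
  end.

(* a^1 ⊗ ... ⊗ a^s |-> (a^1_(-1) ⊗ ... ⊗ a^s_(-1)) ⊗ a^1_(0) ... a^s_(0),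
   with s = n + 1. *)
Fixpoint rcoact n : {linear tpow1 A n -> tpow1 H n ⊗ A} :=
  match n return {linear tpow1 A n -> tpow1 H n ⊗ A} with
  | 0 => r
  | n'.+1 => tmap idfun mA \o tflip \o tmap r (rcoact n')
  end.
End Coaction.

End DiagonalMaps.

Section LinearSums.
Variables (R : comNzRingType) (V W : lmodType R).

(* sum_(i = 1)^n (-1)^i F_(i-1) *)
Definition alt_sum_fun n (F : nat -> {linear V -> W}) (x : V) : W :=
  \sum_(i < n) (-1) ^+ i.+1 *: F i x.
Fact alt_sum_linear n F : linear (alt_sum_fun n F).
Proof.
move=> a x y; rewrite /alt_sum_fun scaler_sumr -big_split /=.
by apply: eq_bigr => i _; rewrite linearP scalerDr !scalerA mulrC.
Qed.
HB.instance Definition _ n F :=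
  GRing.isLinear.Build R V W *:%R (alt_sum_fun n F) (alt_sum_linear n F).
Definition alt_sum n F : {linear V -> W} := alt_sum_fun n F.
End LinearSums.

Section BialgebraCochains.
Variables (R : comNzRingType) (H : lmodType R) (h : bialgebra_on H).

Definition cochH p q := {linear tpow H p -> tpow H q}.

(* The condition that C^{p,q}(H) is 0 if pq = 0. *)
Definition in_cochH p q (f : cochH p q) : Prop :=
  (p * q = 0)%N -> forall x, f x = 0.

Definition dhH p q : cochH p q -> cochH p.+1 q :=
  match p, q return cochH p q -> cochH p.+1 q with
  | p'.+1, q'.+1 => fun f =>
      (lact h q' \o tmap idfun f)
      \+ alt_sum p'.+1 (fun i => f \o mul_at (amul h) i p')
      \+ ((-1) ^+ p'.+2 \*: (ract h q' \o tmap f idfun \o split_last H p'))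
  | _, _ => fun _ => \0
  end.

Definition dvH p q : cochH p q -> cochH p q.+1 :=
  match p, q return cochH p q -> cochH p q.+1 with
  | p'.+1, q'.+1 => fun f =>
      (tmap idfun f \o lcoact h (comul h) p')
      \+ alt_sum q'.+1 (fun i => comul_at (comul h) i q' \o f)
      \+ ((-1) ^+ q'.+2 \*:
            (join_last H q' \o tmap f idfun \o rcoact (amul h) (comul h) p'))
  | _, _ => fun _ => \0
  end.

End BialgebraCochains.

Section ComoduleAlgebraCochains.
Variables (R : comNzRingType) (H : lmodType R) (h : bialgebra_on H).
Variables (A : lmodType R) (a : comodule_algebra_on h A).

(* H^{⊗ q} ⊗ A *)
Definition htens q : lmodType R := if q is q'.+1 then tpow1 H q' ⊗ A else A.

Definition beta_l q : {linear A ⊗ htens q -> htens q} :=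
  match q return {linear A ⊗ htens q -> htens q} with
  | 0 => amul a
  | q'.+1 => tmap (lact h q') (amul a) \o tflip \o tmap (coact a) idfun
  end.

Definition beta_r q : {linear htens q ⊗ A -> htens q} :=
  match q return {linear htens q ⊗ A -> htens q} with
  | 0 => amul a
  | q'.+1 => tmap (ract h q') (amul a) \o tflip \o tmap idfun (coact a)
  end.

(* The identification H ⊗ (H^{⊗ q} ⊗ A) = H^{⊗ q+1} ⊗ A. *)
Definition htens_cons q : {linear H ⊗ htens q -> htens q.+1} :=
  match q return {linear H ⊗ htens q -> htens q.+1} with
  | 0 => idfun
  | _.+1 => tassocV
  end.

(* Delta^q_(i+1) ⊗ id_A *)
Definition htens_comul q i : {linear htens q -> htens q.+1} :=
  match q return {linear htens q -> htens q.+1} with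
  | 0 => \0
  | q'.+1 => tmap (comul_at (comul h) i q') idfun
  end.

(* id_{H^{⊗ q}} ⊗ lambda *)
Definition htens_coact q : {linear htens q -> htens q.+1} :=
  match q return {linear htens q -> htens q.+1} with
  | 0 => coact a
  | q'.+1 => tmap (join_last H q') idfun \o tassocV \o tmap idfun (coact a)
  end.

Definition cochA p q := {linear tpow A p -> htens q}.

(* The conditions that C^{0,q}(A) is 0 and C^{1,0}(A) is Der(A). *)
Definition in_cochA p q : cochA p q -> Prop :=
  match p, q return cochA p q -> Prop with
  | 0, _ => fun f => forall x, f x = 0
  | 1, 0 => fun f => forall x y : A,
      f (amul a (x \ox y)) = amul a (f x \ox y) + amul a (x \ox f y)
  | _, _ => fun _ => True
  end.

Definition dhA p q : cochA p q -> cochA p.+1 q :=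
  match p return cochA p q -> cochA p.+1 q with
  | p'.+1 => fun f =>
      (beta_l q \o tmap idfun f)
      \+ alt_sum p'.+1 (fun i => f \o mul_at (amul a) i p')
      \+ ((-1) ^+ p'.+2 \*: (beta_r q \o tmap f idfun \o split_last A p'))
  | 0 => fun _ => \0
  end.

Definition dvA p q : cochA p q -> cochA p q.+1 :=
  match p return cochA p q -> cochA p q.+1 with
  | p'.+1 => fun f =>
      (htens_cons q \o tmap idfun f \o lcoact h (coact a) p')
      \+ alt_sum q (fun i => htens_comul q i \o f)
      \+ ((-1) ^+ q.+1 \*: (htens_coact q \o f))
  | 0 => fun _ => \0
  end.

(* f |-> (f ⊗ id_A) lambda^p_2 *)
Definition push_coact p q : cochH H p q.+1 -> cochA p q.+1 :=
  match p return cochH H p q.+1 -> cochA p q.+1 with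
  | p'.+1 => fun f => tmap f idfun \o rcoact (amul a) (coact a) p'
  | 0 => fun _ => \0
  end.

Definition coch p q : Type := (cochA p q * cochH H p q.+1)%type.

Definition in_coch p q (c : coch p q) : Prop := in_cochA c.1 /\ in_cochH c.2.

Definition coch0 p q : coch p q :=
  (\0 : cochA p q, \0 : cochH H p q.+1).

Definition coch_add p q (c c' : coch p q) : coch p q :=
  (c.1 \+ c'.1 : cochA p q, c.2 \+ c'.2 : cochH H p q.+1).

Definition coch_scale p q (e : R) (c : coch p q) : coch p q :=
  (e \*: c.1 : cochA p q, e \*: c.2 : cochH H p q.+1).

Definition coch_eq0 p q (c : coch p q) : Prop :=
  (forall x, c.1 x = 0) /\ (forall x, c.2 x = 0).

Definition dh p q (c : coch p q) : coch p.+1 q := (dhA c.1, dhH h c.2).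

Definition dv p q (c : coch p q) : coch p q.+1 :=
  (dvA c.1 \+ ((-1) ^+ q \*: push_coact c.2) : cochA p q.+1, dvH h c.2).

(* Tot^n is the set of families (c_(p,q)), with c_(p,q) in C^{p,q}(A,H), that
   vanish off the antidiagonal p + q = n. *)
Definition tot := forall p q, coch p q.

Definition in_tot n (c : tot) : Prop :=
  forall p q, in_coch (c p q) /\ ((p + q)%N <> n -> coch_eq0 (c p q)).

Definition tot_diff (c : tot) : tot := fun p q =>
  coch_add
    (match p return coch p q with
     | p'.+1 => dh (c p' q)
     | 0 => coch0 0 q
     end)
    (match q return coch p q with
     | q'.+1 => coch_scale ((-1) ^+ p) (dv (c p q'))
     | 0 => coch0 p 0
     end).

Definition in_Zca n (c : tot) : Prop :=
  in_tot n c /\ forall p q, coch_eq0 (tot_diff c p q).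

(* The element c + c' of Tot^2 with c in bidegree (2,0) and c' in (1,1). *)
Definition tot2 (c : coch 2 0) (c' : coch 1 1) : tot := fun p q =>
  match p, q return coch p q with
  | 2, 0 => c
  | 1, 1 => c'
  | p', q' => coch0 p' q'
  end.

End ComoduleAlgebraCochains.

(* Main.v *)
(* The first-order coefficients m1, Delta1, mu1, lambda1 satisfy the equations
   obtained by comparing the coefficients of t in the axioms of the deformed
   structures: associativity of m and mu gives the component of the cocycle
   condition in bidegree (3,0), multiplicativity of Delta and lambda the one in
   bidegree (2,1), coassociativity of Delta and lambda the one in (1,2).  For l = 0
   all four coefficients vanish. *)

Require Import Defs.
From mathcomp Require Import all_boot all_algebra.

Set Implicit Arguments.
Unset Strict Implicit.
Unset Printing Implicit Defensive.

Import GRing.Theory.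
Local Open Scope ring_scope.

(** Turns an order-one identity with two terms on each side into a vanishing alternating sum, with
    the terms in the order produced by the differentials in bidegrees (3,0) and (1,2). *)
Lemma eq_sum_cancel3 (V : zmodType) (a b u v : V) :
  a + b = u + v -> u - b + v - a = 0.
Proof.
by move=> e; rewrite (addrAC u _ v) -(addrA (u + v)) -opprD (addrC b) e subrr.
Qed.

(** The analogue for bidegree (2,1): [u - a + v] is the horizontal part and [w - b + z] the vertical
    one. *)
Lemma eq_sum_cancel4 (V : zmodType) (a b u v w z : V) :
  a + b = w + z + u + v -> u - a + v + (w - b + z) = 0.
Proof.
move=> e; rewrite (addrAC u _ v) (addrAC w _ z) addrACA -opprD e -(addrA (w + z)).
by rewrite (addrC (w + z)) subrr.
Qed.

(** * Functoriality and extensionality for tensor products *)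

Section TensorProducts.
Variable R : comNzRingType.

Lemma eq_tmap (V V' W W' : lmodType R)
    (f f' : {linear V -> V'}) (g g' : {linear W -> W'}) :
  f =1 f' -> g =1 g' -> tmap f g =1 tmap f' g'.
Proof. by move=> ff' gg'; apply: tens_ext => v w; rewrite !tmapE ff' gg'. Qed.

Lemma tmap_comp (V V' V'' W W' W'' : lmodType R)
    (f : {linear V -> V'}) (f' : {linear V' -> V''})
    (g : {linear W -> W'}) (g' : {linear W' -> W''}) z :
  tmap f' g' (tmap f g z) = tmap (f' \o f) (g' \o g) z.
Proof.
elim/tens_ind: z => [v w|z z' IH IH']; first by rewrite !tmapE.
by rewrite !linearD IH IH'.
Qed.

Lemma tmap0l (V V' W W' : lmodType R)
    (f : {linear V -> V'}) (g : {linear W -> W'}) z :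
  f =1 \0 -> tmap f g z = 0.
Proof.
move=> f0; elim/tens_ind: z => [v w|z z' IH IH'].
  by rewrite tmapE f0 tens_0l.
by rewrite linearD IH IH' addr0.
Qed.

Lemma tmap0r (V V' W W' : lmodType R)
    (f : {linear V -> V'}) (g : {linear W -> W'}) z :
  g =1 \0 -> tmap f g z = 0.
Proof.
move=> g0; elim/tens_ind: z => [v w|z z' IH IH'].
  by rewrite tmapE g0 tens_0r.
by rewrite linearD IH IH' addr0.
Qed.

Lemma tmap_id (V W : lmodType R) (z : V ⊗ W) : tmap idfun idfun z = z.
Proof.
elim/tens_ind: z => [v w|z z' IH IH']; first by rewrite tmapE.
by rewrite linearD IH IH'.
Qed.

Lemma tassocK (U V W : lmodType R) : cancel (@tassoc R U V W) tassocV.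
Proof.
apply: (@tens_ext _ _ _ _ (tassocV \o tassoc) idfun) => z w.
elim/tens_ind: z => [u v|z z' IH IH'].
  by apply: etrans (congr1 tassocV (tassocE _ _ _)) (tassocVE _ _ _).
by rewrite tens_Dl !linearD; congr (_ + _).
Qed.

Lemma tens_ext0 (V W P : lmodType R) (f : {linear V ⊗ W -> P}) :
  (forall v w, f (v \ox w) = 0) -> forall x, f x = 0.
Proof. by move=> f0; exact: (@tens_ext _ _ _ _ f \0). Qed.

Lemma tens3_ext0 (U V W P : lmodType R)
    (f : {linear U ⊗ (V ⊗ W) -> P}) :
  (forall u v w, f (u \ox (v \ox w)) = 0) -> forall x, f x = 0.
Proof.
move=> f0; apply: tens_ext0 => u; elim/tens_ind=> [v w|x y IH IH'] //.
by rewrite tens_Dr linearD IH IH' addr0.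
Qed.

End TensorProducts.

Section AlternatingSums.
Variables (R : comNzRingType) (V W : lmodType R).

Lemma alt_sum0 n (F : nat -> {linear V -> W}) x :
  (forall i, F i x = 0) -> alt_sum n F x = 0.
Proof. by move=> F0; apply: big1 => i _; rewrite F0 scaler0. Qed.

Lemma alt_sum1E (F : nat -> {linear V -> W}) x :
  alt_sum 1 F x = - F 0%N x.
Proof. by rewrite /= /alt_sum_fun big_ord1 expr1 scaleN1r. Qed.

Lemma alt_sum2E (F : nat -> {linear V -> W}) x :
  alt_sum 2 F x = - F 0%N x + F 1%N x.
Proof.
by rewrite /= /alt_sum_fun big_ord_recl big_ord1 expr1 scaleN1r sqrrN expr1n scale1r.
Qed.

Lemma sign3 (v : V) : (-1) ^+ 3 *: v = - v.
Proof. by rewrite exprS sqrrN expr1n mulr1 scaleN1r. Qed.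

Lemma sign2 (v : V) : (-1) ^+ 2 *: v = v.
Proof. by rewrite sqrrN expr1n scale1r. Qed.

End AlternatingSums.

(** * Coefficients of t^0 and t^1 over k[t]/(t^{l+1}) *)

Section FirstOrder.
Variables (k : comNzRingType) (l : option nat).
Implicit Types X Y Z W : lmodType k.

Lemma le_order0 : le_order 0 l.
Proof. by case: l. Qed.

Lemma tcoef_sum X I (r : seq I) (F : I -> texp l X) s :
  (\sum_(i <- r) F i) s = \sum_(i <- r) F i s.
Proof. by elim/big_rec2: _ => //= i x y _ <-. Qed.

Lemma tcoef_Xn_scale X i (u : texp l X) s : le_order s l ->
  (trunc_Xn k l i *: u) s = if (i <= s)%N then u (s - i)%N else 0.
Proof.
move=> sl; rewrite tscaleE sl.
(* In the Cauchy sum only the index j = i survives, and it occurs exactly when i is at most s. *)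
have E (j : 'I_s.+1) : (trunc_poly (trunc_Xn k l i))`_j *: u (s - j)%N =
    if j == i :> nat then u (s - i)%N else 0.
  rewrite coef_trunc_Xn ?(le_order_sub _ sl) -1?ltnS //.
  by case: eqP => [->|_]; rewrite ?scale1r ?scale0r.
under eq_bigr => j _ do rewrite E.
case: ltnP => [si|]; last first.
  rewrite -ltnS => is1; rewrite (bigD1 (Ordinal is1)) //= eqxx big1 ?addr0 // => j.
  by rewrite -val_eqE /= => /negPf->.
apply: big1 => j _; case: eqP => // ji.
by have := ltn_ord j; rewrite ji ltnS leqNgt si.
Qed.

(** Expand u as the sum of the t^i u_i and use linearity over k[t]/(t^{l+1}): the terms with i > 0
    do not reach degree 0 in t. *)
Lemma tcoef_app0 X Y (f : {linear texp l X -> texp l Y}) u :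
  f u 0%N = dcoef f 0 (u 0%N).
Proof.
have [N uN] := trunc_pred_fin u.
(* The bound is raised so that the sum has a term of index 0 to split off. *)
have uN1 s : (N.+1 <= s)%N -> u s = 0 by move=> /ltnW; exact: uN.
rewrite {1}(texp_expand uN1) raddf_sum tcoef_sum big_ord_recl /=.
rewrite linearZ_LR tcoef_Xn_scale ?le_order0 // big1 ?addr0 // => i _.
by rewrite linearZ_LR tcoef_Xn_scale ?le_order0.
Qed.

(** Here the terms with i = 0 and i = 1 contribute. For l = 0 every coefficient of t is 0 and both
    sides vanish. *)
Lemma tcoef_app1 X Y (f : {linear texp l X -> texp l Y}) u :
  f u 1%N = dcoef f 1 (u 0%N) + dcoef f 0 (u 1%N).
Proof.
have [l1|l1] := boolP (le_order 1 l); last first.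
  by rewrite !(tcoef_gt _ l1) linear0 addr0 /= /dcoef_fun (tcoef_gt _ l1).
have [N uN] := trunc_pred_fin u.
have uN1 s : (N.+2 <= s)%N -> u s = 0 by move=> /ltnW/ltnW; exact: uN.
rewrite {1}(texp_expand uN1) raddf_sum tcoef_sum !big_ord_recl /=.
rewrite !linearZ_LR !tcoef_Xn_scale // big1 ?addr0 // => i _.
by rewrite linearZ_LR tcoef_Xn_scale.
Qed.

Lemma tident0 X Y (u : texp l X) (v : texp l Y) :
  tident (u \ox v) 0%N = u 0%N \ox v 0%N.
Proof. by rewrite tidentE le_order0 big_ord_recl big_ord0 addr0. Qed.

Lemma tident1 X Y (u : texp l X) (v : texp l Y) :
  tident (u \ox v) 1%N = u 0%N \ox v 1%N + u 1%N \ox v 0%N.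
Proof.
rewrite tidentE; case: ifPn => l1; first by rewrite !big_ord_recl big_ord0 addr0.
by rewrite !(tcoef_gt _ l1) tens_0l tens_0r addr0.
Qed.

Lemma tident_tmapD (U V : lmodType (trunc_ring k l)) X Y
    (f : {linear U -> texp l X}) (g : {linear V -> texp l Y}) z z' s :
  tident (tmap f g (z + z')) s = tident (tmap f g z) s + tident (tmap f g z') s.
Proof. by rewrite (linearD (tmap f g)) (linearD tident) tcoefD. Qed.

(** A Leibniz rule: the single factor t comes from [g], from [f] or from the argument. It is checked
    on pure tensors. *)
Lemma tident_tmap1 X X' Y Y' (f : {linear texp l X -> texp l X'})
    (g : {linear texp l Y -> texp l Y'}) z :
  tident (tmap f g z) 1%N =
    tmap (dcoef f 0) (dcoef g 1) (tident z 0%N) +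
    tmap (dcoef f 1) (dcoef g 0) (tident z 0%N) +
    tmap (dcoef f 0) (dcoef g 0) (tident z 1%N).
Proof.
elim/tens_ind: z => [u v|z z' IH IH']; last first.
  rewrite tident_tmapD IH IH' (linearD tident) !tcoefD !(linearD (tmap _ _)).
  by rewrite addrACA; congr (_ + _); rewrite addrACA.
rewrite tmapE !tident1 (linearD (tmap _ _)) tident0 !tmapE !tcoef_app0 !tcoef_app1.
rewrite tens_Dr tens_Dl -!addrA; congr (_ + _).
by rewrite addrCA.
Qed.

(** The identification [tident] carries the associator over k[t]/(t^{l+1}) to the one over k. On
    pure tensors this compares the explicit formulas [tident0] and [tident1], hence the range of
    [s]. *)
Lemma tident_assoc X Y Z (z : texp l X ⊗ texp l Y ⊗ texp l Z) s : (s <= 1)%N ->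
  tident (tmap idfun tident (tassoc z)) s =
  tassoc (tident (tmap tident idfun z) s).
Proof.
move=> s1; elim/tens_ind: z => [z w|z z' IH IH']; last first.
  by rewrite (linearD tassoc) !tident_tmapD IH IH' (linearD tassoc).
elim/tens_ind: z => [u v|z z' IH IH']; last first.
  by rewrite tens_Dl (linearD tassoc) !tident_tmapD IH IH' (linearD tassoc).
rewrite tassocE !tmapE; case: s s1 => [|[]] // _.
  by rewrite !tident0 tassocE.
by rewrite !tident1 !tident0 !tens_Dr !tens_Dl !(linearD tassoc) !tassocE addrA.
Qed.

(** The same compatibility for the interchange of the two middle factors, which enters the product
    of a tensor product of algebras. *)
Lemma tident_flip X Y Z W (z : texp l X ⊗ texp l Y ⊗ (texp l Z ⊗ texp l W)) s :
  (s <= 1)%N ->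
  tident (tmap tident tident (tflip z)) s =
  tflip (tident (tmap tident tident z) s).
Proof.
move=> s1; elim/tens_ind: z => [z w|z z' IH IH']; last first.
  by rewrite (linearD tflip) !tident_tmapD IH IH' (linearD tflip).
elim/tens_ind: z => [u v|z z' IH IH']; last first.
  by rewrite tens_Dl (linearD tflip) !tident_tmapD IH IH' (linearD tflip).
elim/tens_ind: w => [u' v'|z z' IH IH']; last first.
  by rewrite tens_Dr (linearD tflip) !tident_tmapD IH IH' (linearD tflip).
rewrite tflipE !tmapE; case: s s1 => [|[]] // _.
  by rewrite !tident0 tflipE.
rewrite !tident1 !tident0 !tens_Dr !tens_Dl !(linearD tflip) !tflipE.
by rewrite addrACA.
Qed.

End FirstOrder.

(** * The axioms of the deformed structures modulo t^2 *)

Section FirstOrderAxioms.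
Variables (k : comNzRingType) (l : option nat).
Implicit Types A B : lmodType k.

Lemma tconst0 A (x : A) : tconst l x 0%N = x. Proof. by []. Qed.
Lemma tconst1 A (x : A) : tconst l x 1%N = 0. Proof. by []. Qed.

(** Associativity is evaluated at constants, which have no t-term, so the factor t comes from one of
    the two multiplications. *)
Lemma first_order_assoc A (a : {linear texp l A ⊗ texp l A -> texp l A})
    (f : {linear texp l (A ⊗ A) -> texp l A}) :
  (forall z, a z = f (tident z)) ->
  (forall u v w, a (a (u \ox v) \ox w) = a (u \ox a (v \ox w))) ->
  forall x y z,
    dcoef f 1 (dcoef f 0 (x \ox y) \ox z) + dcoef f 0 (dcoef f 1 (x \ox y) \ox z) =
    dcoef f 1 (x \ox dcoef f 0 (y \ox z)) + dcoef f 0 (x \ox dcoef f 1 (y \ox z)).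
Proof.
move=> aE aA x y z.
have := congr1 (fun u : texp l A => u 1%N) (aA (tconst l x) (tconst l y) (tconst l z)).
rewrite /= !aE !(tcoef_app1, tcoef_app0, tident1, tident0) !tconst0 !tconst1.
by rewrite !(tens_0l, tens_0r) !addr0 !(linear0 (dcoef _ _)) !(addr0, add0r).
Qed.

(** Keeping [r] apart from [d] covers both coassociativity of the coproduct ([r] = [d]) and that of
    the coaction. *)
Lemma first_order_coassoc A B
    (d : {linear texp l A -> texp l A ⊗ texp l A})
    (r : {linear texp l B -> texp l A ⊗ texp l B})
    (D : {linear texp l A -> texp l (A ⊗ A)})
    (E : {linear texp l B -> texp l (A ⊗ B)}) :
  (forall u, tident (d u) = D u) -> (forall u, tident (r u) = E u) ->
  (forall u, tassoc (tmap d idfun (r u)) = tmap idfun r (r u)) ->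
  forall x,
    tassoc (tmap (dcoef D 1) idfun (dcoef E 0 x)) +
    tassoc (tmap (dcoef D 0) idfun (dcoef E 1 x)) =
    tmap idfun (dcoef E 1) (dcoef E 0 x) + tmap idfun (dcoef E 0) (dcoef E 1 x).
Proof.
move=> dE rE dA x.
(* Two identifications are needed to reach the module of polynomials over A ⊗ (A ⊗ B), where the
   coefficient of t can be read. *)
have := congr1 (fun u => tident (tmap idfun tident u) 1%N) (dA (tconst l x)).
rewrite /= tident_assoc // !tmap_comp.
rewrite (eq_tmap (f' := D) (g' := idfun)) // (eq_tmap (f' := idfun) (g' := E)) //.
rewrite !tident_tmap1 !rE -/(dcoef_fun E 0 x) -/(dcoef_fun E 1 x).
(* The identity map has zero coefficient at t, so on each side one of the three Leibniz terms drops
   out. *)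
rewrite [X in tassoc (X + _ + _) = _]tmap0r // add0r.
by rewrite [X in _ = _ + X + _]tmap0l // addr0 linearD.
Qed.

(** On the right the factor t has four possible sources: the product of B, that of A, and the
    coaction on either argument. The case A = B with [r] the coproduct is multiplicativity of the
    coproduct. *)
Lemma first_order_mul A B
    (a : {linear texp l A ⊗ texp l A -> texp l A})
    (b : {linear texp l B ⊗ texp l B -> texp l B})
    (r : {linear texp l B -> texp l A ⊗ texp l B})
    (M : {linear texp l (A ⊗ A) -> texp l A})
    (N : {linear texp l (B ⊗ B) -> texp l B})
    (E : {linear texp l B -> texp l (A ⊗ B)}) :
  (forall z, a z = M (tident z)) -> (forall z, b z = N (tident z)) ->
  (forall u, tident (r u) = E u) ->
  (forall u v, r (b (u \ox v)) = tens_mul a b (r u \ox r v)) ->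
  forall x y,
    dcoef E 1 (dcoef N 0 (x \ox y)) + dcoef E 0 (dcoef N 1 (x \ox y)) =
    tmap (dcoef M 0) (dcoef N 1) (tflip (dcoef E 0 x \ox dcoef E 0 y)) +
    tmap (dcoef M 1) (dcoef N 0) (tflip (dcoef E 0 x \ox dcoef E 0 y)) +
    tmap (dcoef M 0) (dcoef N 0) (tflip (dcoef E 0 x \ox dcoef E 1 y)) +
    tmap (dcoef M 0) (dcoef N 0) (tflip (dcoef E 1 x \ox dcoef E 0 y)).
Proof.
move=> aE bE rE rM x y.
have := congr1 (fun u => tident u 1%N) (rM (tconst l x) (tconst l y)).
rewrite /= rE bE tcoef_app1 tcoef_app0 tcoef_app1 tident0 tident1.
rewrite !tconst0 !tconst1 tens_0l tens_0r !(addr0, linear0).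
(* Factoring [tident] out of both products brings the term into the form to which [tident_flip]
   applies. *)
rewrite (eq_tmap (f' := M \o tident) (g' := N \o tident)) // -tmap_comp.
rewrite tident_tmap1 !tident_flip // tmapE !rE tident0 tident1 => ->.
by rewrite !linearD addrA.
Qed.

End FirstOrderAxioms.

(** * Reduction of the cocycle condition to three bidegrees *)

Section ZeroCochains.
Variables (R : comNzRingType) (H : lmodType R) (h : bialgebra_on H).
Variables (A : lmodType R) (a : comodule_algebra_on h A).

Lemma dhH_eq0 p q (f : cochH H p q) : f =1 \0 -> dhH h f =1 \0.
Proof.
case: p q f => [|p] [|q] f f0 x //=.
rewrite tmap0r // linear0 add0r alt_sum0 => [|i]; last exact: f0.
by rewrite tmap0l // linear0 scaler0 addr0.
Qed.

Lemma dvH_eq0 p q (f : cochH H p q) : f =1 \0 -> dvH h f =1 \0.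
Proof.
case: p q f => [|p] [|q] f f0 x //=.
rewrite tmap0r // add0r alt_sum0 => [|i]; last by rewrite /= f0 linear0.
by rewrite tmap0l // linear0 scaler0 addr0.
Qed.

Lemma dhA_eq0 p q (f : cochA H A p q) : f =1 \0 -> dhA a f =1 \0.
Proof.
case: p f => [|p] f f0 x //=.
rewrite tmap0r // linear0 add0r alt_sum0 => [|i]; last exact: f0.
by rewrite tmap0l // linear0 scaler0 addr0.
Qed.

Lemma dvA_eq0 p q (f : cochA H A p q) : f =1 \0 -> dvA a f =1 \0.
Proof.
case: p f => [|p] f f0 x //=.
rewrite tmap0r // linear0 add0r alt_sum0 => [|i]; last by rewrite /= f0 linear0.
by rewrite f0 linear0 scaler0 addr0.
Qed.

Lemma push_coact_eq0 p q (f : cochH H p q.+1) : f =1 \0 -> push_coact a f =1 \0.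
Proof. by case: p f => [|p] f f0 x //=; rewrite tmap0l. Qed.

Lemma dh_eq0 p q (c : coch H A p q) : coch_eq0 c -> coch_eq0 (dh a c).
Proof. by case=> c1 c2; split; [exact: dhA_eq0 | exact: dhH_eq0]. Qed.

Lemma dv_eq0 p q (c : coch H A p q) : coch_eq0 c -> coch_eq0 (dv a c).
Proof.
case=> c1 c2; split=> x; last exact: dvH_eq0.
by rewrite /= dvA_eq0 // push_coact_eq0 // scaler0 addr0.
Qed.

Lemma coch_scale_eq0 p q e (c : coch H A p q) : coch_eq0 c -> coch_eq0 (coch_scale e c).
Proof. by case=> c1 c2; split=> x; rewrite /= ?c1 ?c2 scaler0. Qed.

Lemma coch_add_eq0 p q (c c' : coch H A p q) :
  coch_eq0 c -> coch_eq0 c' -> coch_eq0 (coch_add c c').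
Proof.
by move=> [c1 c2] [c1' c2']; split=> x; rewrite /= ?c1 ?c1' ?c2 ?c2' addr0.
Qed.

Lemma in_tot2 (c : coch H A 2 0) (c' : coch H A 1 1) : in_tot a 2 (tot2 c c').
Proof.
have in0 p q : in_coch a (coch0 H A p q).
  (* The case left over is (1,0), where the zero map has to be a derivation. *)
  split=> //; case: p => [|[|p]] //; case: q => [|q] // x y /=.
  by rewrite tens_0l tens_0r !linear0 addr0.
by move=> [|[|[|p]]] [|[|q]]; split=> //; exact: in0.
Qed.

(** The differential of an element supported in (2,0) and (1,1) is supported in (3,0), (2,1) and
    (1,2); every other component comes from zero cochains. *)
Lemma tot2_cocycle (c : coch H A 2 0) (c' : coch H A 1 1) :
  coch_eq0 (dh a c) ->
  coch_eq0 (coch_add (dh a c') (dv a c)) ->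
  coch_eq0 (dv a c') ->
  in_Zca a 2 (tot2 c c').
Proof.
move=> dhc dhvc dvc; split; first exact: in_tot2.
have dv0 p q e : coch_eq0 (coch_scale e (dv a (coch0 H A p q))).
  exact/coch_scale_eq0/dv_eq0.
have dh0 p q : coch_eq0 (dh a (coch0 H A p q)) by exact: dh_eq0.
move=> [|[|[|[|p]]]] [|[|[|q]]]; rewrite /tot_diff /=; try by apply: coch_add_eq0.
(* Bidegree (1,2): the sign (-1)^1 does not affect vanishing. *)
- apply: coch_add_eq0 => //; exact: coch_scale_eq0.
(* Bidegree (2,1): the vertical part carries the sign (-1)^2 = 1. *)
- case: dhvc => e1 e2; rewrite sqrrN expr1n; split=> x.
    exact: etrans (congr1 (+%R _) (scale1r _)) (e1 x).
  exact: etrans (congr1 (+%R _) (scale1r _)) (e2 x).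
Qed.

End ZeroCochains.

(** * Explicit differentials in bidegrees (2,0) and (1,1) *)

(* Below the differentials are unfolded by conversion to explicit terms, because
   simplification would also unfold tmap, tflip and tassoc. *)
Section LowDegreeDifferentials.
Variables (R : comNzRingType) (H : lmodType R) (h : bialgebra_on H).

(** For q = 1 both diagonal actions are the multiplication, so this is the Hochschild coboundary of
    a 2-cochain. *)
Lemma dhH21E (f : cochH H 2 1) x y z :
  dhH h f (x \ox (y \ox z)) =
    amul h (x \ox f (y \ox z)) +
    (- f (amul h (x \ox y) \ox z) + f (x \ox amul h (y \ox z)))
    - amul h (f (x \ox y) \ox z).
Proof.
rewrite -[LHS]/(amul h (tmap idfun f (x \ox (y \ox z))) +
  alt_sum 2 (fun i => f \o mul_at (amul h) i 1) (x \ox (y \ox z)) +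
  (-1) ^+ 3 *: amul h (tmap f idfun (tassocV (tmap idfun idfun (x \ox (y \ox z)))))).
rewrite alt_sum2E sign3 !tmapE tassocVE tmapE.
rewrite -[X in _ + (- X + _)]/(f (tmap (amul h) idfun (tassocV (x \ox (y \ox z))))).
rewrite -[X in _ + (_ + X)]/(f (tmap idfun (amul h) (x \ox (y \ox z)))).
by rewrite tassocVE !tmapE.
Qed.

Lemma dhH12E (f : cochH H 1 2) x y :
  dhH h f (x \ox y) =
    tmap (amul h) (amul h) (tflip (comul h x \ox f y)) - f (amul h (x \ox y)) +
    tmap (amul h) (amul h) (tflip (f x \ox comul h y)).
Proof.
rewrite -[LHS]/(tmap (amul h) (amul h)
    (tflip (tmap (comul h) idfun (tmap idfun f (x \ox y)))) +
  alt_sum 1 (fun i => f \o mul_at (amul h) i 0) (x \ox y) +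
  (-1) ^+ 2 *: tmap (amul h) (amul h)
    (tflip (tmap idfun (comul h) (tmap f idfun (x \ox y))))).
by rewrite alt_sum1E sign2 !tmapE.
Qed.

Lemma dvH21E (f : cochH H 2 1) x y :
  dvH h f (x \ox y) =
    tmap (amul h) f (tflip (comul h x \ox comul h y)) - comul h (f (x \ox y)) +
    tmap f (amul h) (tflip (comul h x \ox comul h y)).
Proof.
rewrite -[LHS]/(tmap idfun f (tmap (amul h) idfun
    (tflip (tmap (comul h) (comul h) (x \ox y)))) +
  alt_sum 1 (fun i => comul_at (comul h) i 0 \o f) (x \ox y) +
  (-1) ^+ 2 *: tmap f idfun (tmap idfun (amul h)
    (tflip (tmap (comul h) (comul h) (x \ox y))))).
by rewrite alt_sum1E sign2 !tmapE !tmap_comp.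
Qed.

(** The dual of the Hochschild coboundary, that is, the Cartier coboundary of the coalgebra H. *)
Lemma dvH12E (f : cochH H 1 2) x :
  dvH h f x =
    tmap idfun f (comul h x) +
    (- tassoc (tmap (comul h) idfun (f x)) + tmap idfun (comul h) (f x)) -
    tassoc (tmap f idfun (comul h x)).
Proof.
rewrite -[LHS]/(tmap idfun f (comul h x) +
  alt_sum 2 (fun i => comul_at (comul h) i 1 \o f) x +
  (-1) ^+ 3 *: tmap idfun idfun (tassoc (tmap f idfun (comul h x)))).
rewrite alt_sum2E sign3; congr (_ + _ - _).
exact: tmap_id.
Qed.

Variables (A : lmodType R) (a : comodule_algebra_on h A).

Lemma dhA20E (f : cochA H A 2 0) x y z :
  dhA a f (x \ox (y \ox z)) =
    amul a (x \ox f (y \ox z)) +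
    (- f (amul a (x \ox y) \ox z) + f (x \ox amul a (y \ox z)))
    - amul a (f (x \ox y) \ox z).
Proof.
rewrite -[LHS]/(amul a (tmap idfun f (x \ox (y \ox z))) +
  alt_sum 2 (fun i => f \o mul_at (amul a) i 1) (x \ox (y \ox z)) +
  (-1) ^+ 3 *: amul a (tmap f idfun (tassocV (tmap idfun idfun (x \ox (y \ox z)))))).
rewrite alt_sum2E sign3 !tmapE tassocVE tmapE.
rewrite -[X in _ + (- X + _)]/(f (tmap (amul a) idfun (tassocV (x \ox (y \ox z))))).
rewrite -[X in _ + (_ + X)]/(f (tmap idfun (amul a) (x \ox (y \ox z)))).
by rewrite tassocVE !tmapE.
Qed.

Lemma dhA11E (f : cochA H A 1 1) x y :
  dhA a f (x \ox y) =
    tmap (amul h) (amul a) (tflip (coact a x \ox f y)) - f (amul a (x \ox y)) +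
    tmap (amul h) (amul a) (tflip (f x \ox coact a y)).
Proof.
rewrite -[LHS]/(tmap (amul h) (amul a)
    (tflip (tmap (coact a) idfun (tmap idfun f (x \ox y)))) +
  alt_sum 1 (fun i => f \o mul_at (amul a) i 0) (x \ox y) +
  (-1) ^+ 2 *: tmap (amul h) (amul a)
    (tflip (tmap idfun (coact a) (tmap f idfun (x \ox y))))).
by rewrite alt_sum1E sign2 !tmapE.
Qed.

(** For q = 0 the sum over coproduct faces is empty. The further term required by multiplicativity
    of the coaction is [push_coact20E]. *)
Lemma dvA20E (f : cochA H A 2 0) x y :
  dvA a f (x \ox y) =
    tmap (amul h) f (tflip (coact a x \ox coact a y)) - coact a (f (x \ox y)).
Proof.
rewrite -[LHS]/(tmap idfun f (tmap (amul h) idfun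
    (tflip (tmap (coact a) (coact a) (x \ox y)))) +
  alt_sum 0 (fun i => htens_comul h A 0 i \o f) (x \ox y) +
  (-1) ^+ 1 *: coact a (f (x \ox y))).
rewrite [alt_sum _ _ _]big_ord0 addr0 expr1 scaleN1r.
by rewrite !tmapE !tmap_comp.
Qed.

(** Three of the four terms of coassociativity of the coaction; [push_coact11E], entering with sign
    (-1)^1, is the fourth. *)
Lemma dvA11E (f : cochA H A 1 1) x :
  dvA a f x =
    tassocV (tmap idfun f (coact a x)) - tmap (comul h) idfun (f x) +
    tassocV (tmap idfun (coact a) (f x)).
Proof.
rewrite -[LHS]/(tassocV (tmap idfun f (coact a x)) +
  alt_sum 1 (fun i => htens_comul h A 1 i \o f) x +
  (-1) ^+ 2 *: tmap idfun idfun (tassocV (tmap idfun (coact a) (f x)))).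
by rewrite alt_sum1E sign2 tmap_id.
Qed.

Lemma push_coact20E (f : cochH H 2 1) x y :
  push_coact a f (x \ox y) = tmap f (amul a) (tflip (coact a x \ox coact a y)).
Proof.
rewrite -[LHS]/(tmap f idfun (tmap idfun (amul a)
    (tflip (tmap (coact a) (coact a) (x \ox y))))).
by rewrite !tmapE !tmap_comp.
Qed.

Lemma push_coact11E (f : cochH H 1 2) x :
  push_coact a f x = tmap f idfun (coact a x).
Proof. by []. Qed.

End LowDegreeDifferentials.

Theorem proposition6p2 (k : closedFieldType) (char0 : [pchar k] =i pred0)
    (N : nat)
    (H : lmodType k) (h : hopf_on H) (gH : grading H N) (hgr : graded_hopf h gH)
    (G : lmodType k) (g : comodule_algebra_on h G) (gG : grading G N)
    (ggr : graded_comodule_algebra gH g gG)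
    (l : option nat) (D : deformation h gH l)
    (E : comodule_deformation D g gG) :
  in_Zca g 2 (tot2 (dcoef (def_amul E) 1, dcoef (def_mul D) 1)
                   (dcoef (def_coact E) 1, dcoef (def_comul D) 1)).
Proof.
have Hassoc := first_order_assoc (def_mulE D) (amulA D).
have Gassoc := first_order_assoc (def_amulE E) (amulA E).
have Hmul := first_order_mul (def_mulE D) (def_mulE D) (def_comulE D) (comulM D).
have Gmul := first_order_mul (def_mulE D) (def_amulE E) (def_coactE E) (coactM E).
have Hco := first_order_coassoc (def_comulE D) (def_comulE D) (comulA D).
have Gco := first_order_coassoc (def_comulE D) (def_coactE E) (coactA E).
have m0 := def_mul0 D; have d0 := def_comul0 D.
have a0 := def_amul0 E; have c0 := def_coact0 E.
(* The goals are the G-component and then the H-component in bidegrees (3,0), (2,1) and (1,2), in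
   this order. *)
apply: tot2_cocycle; split.
- apply: tens3_ext0 => x y z; rewrite [LHS]dhA20E.
  have := Gassoc x y z; rewrite !a0 => e.
  by rewrite addrA; apply: eq_sum_cancel3; rewrite addrC e addrC.
- apply: tens3_ext0 => x y z; rewrite [LHS]dhH21E.
  have := Hassoc x y z; rewrite !m0 => e.
  by rewrite addrA; apply: eq_sum_cancel3; rewrite addrC e addrC.
- apply: tens_ext0 => x y.
  rewrite -[LHS]/(dhA g (dcoef (def_coact E) 1 : cochA H G 1 1) (x \ox y) +
    (dvA g (dcoef (def_amul E) 1 : cochA H G 2 0) (x \ox y) +
     (-1) ^+ 0 *: push_coact g (dcoef (def_mul D) 1 : cochH H 2 1) (x \ox y))).
  rewrite dhA11E dvA20E push_coact20E expr0 scale1r.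
  have := Gmul x y.
  (* Coefficients at t^0 become the undeformed structure maps. *)
  rewrite !c0 !a0 !(eq_tmap m0 (frefl _)) !(eq_tmap (frefl _) a0) => e.
  exact: eq_sum_cancel4.
- apply: tens_ext0 => x y.
  rewrite -[LHS]/(dhH h (dcoef (def_comul D) 1 : cochH H 1 2) (x \ox y) +
    dvH h (dcoef (def_mul D) 1 : cochH H 2 1) (x \ox y)).
  rewrite dhH12E dvH21E.
  have := Hmul x y.
  rewrite !d0 !m0 !(eq_tmap m0 (frefl _)) !(eq_tmap (frefl _) m0) => e.
  exact: eq_sum_cancel4.
- move=> x.
  rewrite -[LHS]/(dvA g (dcoef (def_coact E) 1 : cochA H G 1 1) x +
    (-1) ^+ 1 *: push_coact g (dcoef (def_comul D) 1 : cochH H 1 2) x).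
  rewrite dvA11E push_coact11E expr1 scaleN1r.
  (* [Gco] is an identity in H ⊗ (H ⊗ G), while cochains take values in (H ⊗ H) ⊗ G. *)
  have := congr1 tassocV (Gco x).
  rewrite !(linearD tassocV) !tassocK !c0.
  rewrite (eq_tmap d0 (frefl _)) (eq_tmap (frefl _) c0) => e.
  exact: eq_sum_cancel3.
- move=> x; rewrite [LHS]dvH12E.
  have := Hco x; rewrite !d0 (eq_tmap d0 (frefl _)) (eq_tmap (frefl _) d0) => e.
  by rewrite addrA; exact: eq_sum_cancel3.
Qed.
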